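(* For every $(x,y)$ in the interior of the trapezoid $\mathrm T=\{(x,y)\in\mathbb R^2:0\le y\le 1,\ 0\le x\le 2-y\}$, $$D_1^+V_{\mathrm T}(x,y)=\frac{\sqrt{2-y}}{\sqrt2\,\sqrt x\,\sqrt{2-x-y}}=\frac{1}{\sqrt2\,\widetilde\Phi_x(x,y)},$$ $$D_2^+V_{\mathrm T}(x,y)=\max\left\{\frac{\sqrt{2-x}}{\sqrt2\,\sqrt y\,\sqrt{2-x-y}},\ \frac{1}{\sqrt{y(1-y)}}\right\},$$ and consequently $$\widetilde\Phi_y(x,y)\le\frac{1}{D_2^+V_{\mathrm T}(x,y)}\le\sqrt2\,\widetilde\Phi_y(x,y).$$ Here $$\widetilde\Phi_x(x,y)=\sqrt{\frac{x(2-x-y)}{2-y}},\qquad \widetilde\Phi_y(x,y)=\min\left\{\sqrt{y(1-y)},\ \frac{\sqrt y\,\sqrt{2-x-y}}{\sqrt{2-x}}\right\}.$$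
   Context: $\mathbb R^2$ is regarded as the subset of $\mathbb C^2$ of points with real coordinates. For a compact set $E\subset\mathbb C^d$, the Siciak (Siciak–Zakharyuta) extremal function is $$V_E(z)=\sup\{u(z):u\in\mathfrak L_d,\ u|_E\le0\},\qquad z\in\mathbb C^d,$$ where $\mathfrak L_d$ is the Lelong class of plurisubharmonic functions $u$ on $\mathbb C^d$ with $u(z)\le\log\bigl(1+\sqrt{|z_1|^2+\dots+|z_d|^2}\bigr)+O(1)$. Equivalently, $V_E(z)=\log\sup\{|P(z)|^{1/\deg P}:P\text{ a polynomial on }\mathbb C^d,\ \deg P\ge1,\ \sup_E|P|\le1\}$. For a compact set $E\subset\mathbb R^d$, a point $x$ in the interior of $E$ (relative to $\mathbb R^d$), and the standard basis vectors $e_1,\dots,e_d$, the Dini derivative is $$D_j^+V_E(x)=\liminf_{\epsilon\to0^+}\frac{V_E(x+i\,\epsilon\,e_j)}{\epsilon},\qquad j=1,\dots,d.$$ *)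

(* Defs.v *)
From mathcomp Require Import all_boot all_order all_algebra.
From mathcomp Require Import all_classical all_reals all_analysis.
From mathcomp Require Import complex.

Set Implicit Arguments.
Unset Strict Implicit.
Unset Printing Implicit Defensive.

Import Order.TTheory GRing.Theory Num.Theory.
Import numFieldNormedType.Exports.

Local Open Scope classical_set_scope.
Local Open Scope complex_scope.
Local Open Scope ring_scope.

Section ExtremalFunction.
Context {R : realType}.

(* The regular module R[i]^o is R[i] with its usual topology; C^d is the space
   of row vectors over it. *)
Local Notation C := (R[i]^o).

Definition upper_semicontinuous (X : topologicalType) (u : X -> \bar R) :=
  lower_semicontinuous (\- u)%E.

(* Functions C -> [-oo, +oo[ with the local sub-mean value inequality. The
   function constantly -oo is allowed; this does not affect the supremum in
   [siciak]. The integral is well defined: v is bounded above on the circle. *)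
Definition subharmonic (v : C -> \bar R) :=
  [/\ forall a, (v a < +oo)%E,
      upper_semicontinuous v &
      forall a : C, exists2 rho : R, 0 < rho &
        forall r : R, 0 <= r < rho ->
          (v a <= (((2 * pi)^-1)%R)%:E *
             \int[@lebesgue_measure R]_(t in `[0%R, (2 * pi)%R])
               v (a + r%:C * (cos t +i* sin t))%R)%E].

Definition plurisubharmonic d (u : 'rV[C]_d -> \bar R) :=
  [/\ forall z, (u z < +oo)%E,
      upper_semicontinuous u &
      forall a b : 'rV[C]_d, subharmonic (fun l : C => u (a + l *: b))].

(* [Normc.normc] is the R-valued modulus of a complex number. *)
Definition enorm d (z : 'rV[C]_d) : R :=
  Num.sqrt (\sum_(k < d) Normc.normc (z 0 k) ^+ 2).

Definition lelong d : set ('rV[C]_d -> \bar R) :=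
  [set u | plurisubharmonic u /\
    exists M : R, forall z, (u z <= (ln (1 + enorm z) + M)%:E)%E].

Definition siciak d (E : set 'rV[C]_d) (z : 'rV[C]_d) : \bar R :=
  ereal_sup [set u z | u in
    [set u | lelong u /\ forall w, E w -> (u w <= 0)%E]].

Definition of_real d (x : 'rV[R]_d) : 'rV[C]_d := \row_(k < d) (x 0 k)%:C.

Definition dini d (E : set 'rV[R]_d) (j : 'I_d) (x : 'rV[R]_d) : \bar R :=
  limf_einf (fun eps : R =>
    siciak (@of_real d @` E)
      (of_real x + (0 +i* eps : C) *: delta_mx 0 j)%R / eps%:E)%E (0^'+).

Definition trapezoid : set 'rV[R]_2 :=
  [set p | 0 <= p 0 1 <= 1 /\ 0 <= p 0 0 <= 2 - p 0 1].

Definition Phix (x y : R) : R := Num.sqrt (x * (2 - x - y) / (2 - y)).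

Definition Phiy (x y : R) : R :=
  Num.min (Num.sqrt (y * (1 - y)))
          (Num.sqrt y * Num.sqrt (2 - x - y) / Num.sqrt (2 - x)).

End ExtremalFunction.

Arguments trapezoid : clear implicits.

(* Main.v *)
Require Import Defs.
From mathcomp Require Import all_boot all_order all_algebra.
From mathcomp Require Import all_classical all_reals all_analysis.
From mathcomp Require Import complex.
From mathcomp Require Import ring lra.
Set Implicit Arguments.
Unset Strict Implicit.
Unset Printing Implicit Defensive.
Import Order.TTheory GRing.Theory Num.Theory.
Import numFieldNormedType.Exports.
Local Open Scope classical_set_scope.
Local Open Scope ring_scope.

(* Lower bounds. If l_0, l_1, l_2 are affine, nonnegative on E and of sum 1, and
   if |a_0 t_0 + a_1 t_1 + a_2 t_2| <= 1 for every real unit vector t, then the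
   average P_k of (a.s)^(2k) over the signs of the square roots s_i of l_i is a
   polynomial of degree k in the l_i that is bounded by 1 on E. As k grows,
   |P_k|^(1/k) recovers the largest branch of |a.s|^2; the best choice of a gives
   V_E >= log (h + sqrt (h^2 - 1)) with h = |l_0| + |l_1| + |l_2|. On the
   trapezoid take the barycentric coordinates of the triangle with sides x = 0,
   y = 0, x + y = 2, or (0, y, 1 - y).
   Upper bounds. If E contains an ellipse, V_E is at most log |zeta| on its
   complexification c + zeta a + b / zeta, b being the conjugate of a. As the
   class of admissible u is only known to be subharmonic on complex lines, not
   on conics, u is extended to A a + B b with a penalty K |A B - 1|^2. For each
   point and direction some ellipse in the trapezoid matches the lower bound to
   first order. *)

(** * Means over circles *)

(** The two bounds agree because both come down to tangency. At imaginary distance e the excess h -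
    1 is of order e^2, so log (h + sqrt (h^2 - 1)) behaves like sqrt (2 (h - 1)), which is linear in
    e. An ellipse through the point whose tangent there has direction e_j, with conjugate
    semi-diameter s e_j, gives the upper slope 1 / s; when it touches the lines on which the moving
    l_i vanish, 1 / s is the lower slope. The ellipse must also stay in the trapezoid. In direction
    x it lies below the level of the point, so the side y = 1 is harmless and one formula suffices.
    In direction y the ellipse tangent to x = 0, y = 0, x + y = 2 crosses y = 1 exactly when x + x y
    < 2; the one tangent to x = 0, y = 0, y = 1 then fits. On the curve x + x y = 2 one ellipse
    touches all four sides and the two terms of the maximum coincide. *)

Section CircleIntegral.
Context {R : realType}.
Implicit Types (f g : R -> R) (c p q : R).

(* Stated through a primitive, so that linearity and the substitutions below
   are statements about derivatives. *)
Definition circle_integral f c :=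
  exists2 G : R -> R, forall t : R, -1 < t -> is_derive t (1 : R) G (f t) &
    G (2 * pi) - G 0 = c.

(** The base point -1 leaves room to the left of 0, so that the derivative is two-sided on all of
    [0, 2 pi]. *)
Lemma exists_primitive f : continuous f ->
  exists G : R -> R, forall t : R, -1 < t -> is_derive t (1 : R) G (f t).
Proof.
move=> cf.
exists (fun x => (\int[@lebesgue_measure R]_(t in `[-1, x]) f t)%R) => t lt1t.
have tt1 : t < t + 1 by rewrite ltrDl.
have intf : lebesgue_measure.-integrable `[-1, t + 1] (EFin \o f).
  by apply: continuous_compact_integrable; [exact: segment_compact|
    exact: continuous_subspaceT].
have [dG G'] := continuous_FTC1_closed tt1 intf lt1t (cf t).
by apply: DeriveDef => //; rewrite -derive1E.
Qed.

Lemma derive0_const (K : R -> R) a x y : a < x -> x <= y ->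
  (forall t : R, a < t -> is_derive t (1 : R) K 0) -> K x = K y.
Proof.
move=> ax xy dK.
have K' (t : R) : x <= t -> is_derive t (1 : R) K 0
  by move=> xt; apply: dK; exact: lt_le_trans xt.
have [||z _] := @MVT_segment R K (fun=> 0) x y xy.
- by move=> t; rewrite in_itv /= => /andP[/ltW/K'].
- apply: derivable_within_continuous => t; rewrite in_itv /= => /andP[/K' dt _].
  exact: ex_derive.
- by rewrite mul0r => /eqP; rewrite subr_eq0 => /eqP.
Qed.

Lemma circle_integralE f c : continuous f -> circle_integral f c ->
  (\int[@lebesgue_measure R]_(t in `[0%R, (2 * pi)%R]) (f t)%:E = c%:E)%E.
Proof.
move=> cf [G dG <-].
have pi2 : 0 < 2 * pi :> R by rewrite mulr_gt0 ?pi_gt0.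
have dG0 (t : R) : 0 <= t -> is_derive t (1 : R) G (f t).
  by move=> t0; apply: dG; rewrite (lt_le_trans _ t0) // ltrN10.
have cG (t : R) : 0 <= t -> {for t, continuous G}.
  by move=> /dG0 dt; apply/differentiable_continuous/derivable1_diffP/ex_derive.
rewrite (@continuous_FTC2 R f G 0 (2 * pi) pi2) ?EFinB //.
- exact: continuous_subspaceT.
- split.
  + by move=> t; rewrite in_itv/= => /andP[/ltW/dG0 dt _]; exact: ex_derive.
  + by apply: cvg_at_right_filter; exact: cG.
  + by apply: cvg_at_left_filter; apply: cG; exact: ltW.
- by move=> t; rewrite in_itv/= => /andP[/ltW/dG0 dt _]; rewrite derive1E derive_val.
Qed.

Lemma circle_integralD f g c d : circle_integral f c -> circle_integral g d ->
  circle_integral (fun t => f t + g t) (c + d).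
Proof.
move=> [F dF <-] [G dG <-]; exists (F + G); last by rewrite !fctE; ring.
by move=> t t1; have := dF _ t1; have := dG _ t1 => *; exact: is_deriveD.
Qed.

Lemma circle_integralZ k f c : circle_integral f c ->
  circle_integral (fun t => k * f t) (k * c).
Proof.
move=> [F dF <-]; exists (k *: F); last by rewrite !fctE /GRing.scale /=; ring.
by move=> t t1; have := dF _ t1 => ?; exact: is_deriveZ.
Qed.

Lemma circle_integral_cst k : circle_integral (fun=> k) (2 * pi * k).
Proof.
exists (fun t => k * t) => [t _|]; last by ring.
by apply: is_derive_eq; rewrite ?scaler0 ?add0r ?mulr1 //= /GRing.scale /=; ring.
Qed.

Lemma cos_circle_integral : circle_integral (@cos R) 0.
Proof.
exists (@sin R) => [t _|]; first exact: is_derive_sin.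
by rewrite mulr_natl sin2pi sin0 subrr.
Qed.

Lemma cos2_circle_integral : circle_integral (fun t => cos t ^+ 2 - sin t ^+ 2) 0.
Proof.
exists (fun t => sin t * cos t) => [t _|].
  by apply: is_derive_eq; rewrite /GRing.scale /=; ring.
by rewrite mulr_natl sin2pi sin0 !mul0r subrr.
Qed.

Lemma sin2_circle_integral : circle_integral (fun t => sin t * cos t) 0.
Proof.
exists (fun t => 2^-1 * sin t ^+ 2) => [t _|].
  by apply: is_derive_eq; rewrite /GRing.scale /=; field.
by rewrite mulr_natl sin2pi sin0 subrr.
Qed.

(* |1 + (p + iq) e^(it)|^2 *)
Definition circle_sq p q t : R := 1 + 2 * (p * cos t - q * sin t) + (p ^+ 2 + q ^+ 2).

(** With c = p + iq and u the real part of c e^(it), the value is 1 + 2u + |c|^2 and |u| <= |c|, so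
    it lies between (1 - |c|)^2 and (1 + |c|)^2. *)
Lemma circle_sq_bounds p q t s : 0 <= s < 1 -> p ^+ 2 + q ^+ 2 <= s ^+ 2 ->
  (1 - s) ^+ 2 <= circle_sq p q t <= 4.
Proof.
move=> /andP[s0 s1] pqs; rewrite /circle_sq.
set N := p ^+ 2 + q ^+ 2; set u := p * cos t - q * sin t.
have N0 : 0 <= N by rewrite addr_ge0 // sqr_ge0.
have uN : u ^+ 2 <= N.
  have -> : N = u ^+ 2 + (p * sin t + q * cos t) ^+ 2.
    by rewrite -[LHS]mulr1 -(cos2Dsin2 t) /N /u; ring.
  by rewrite lerDl sqr_ge0.
have [r r0 rN] : exists2 r, 0 <= r & N = r ^+ 2.
  by exists (Num.sqrt N); [exact: sqrtr_ge0|rewrite sqr_sqrtr].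
have rs : r <= s by rewrite -ler_sqr // ?nnegrE // -rN.
have ur : `|u| <= r by rewrite -ler_sqr ?nnegrE // real_normK ?num_real // -rN.
move: ur; rewrite ler_norml => /andP[ru ur].
by rewrite rN; apply/andP; split; nra.
Qed.

Lemma circle_sq_gt0 p q t : p ^+ 2 + q ^+ 2 < 1 -> 0 < circle_sq p q t.
Proof.
move=> pq1; have N0 : 0 <= p ^+ 2 + q ^+ 2 by rewrite addr_ge0 // sqr_ge0.
have s1 : Num.sqrt (p ^+ 2 + q ^+ 2) < 1 by rewrite -sqrtr1 ltr_sqrt.
have := @circle_sq_bounds p q t _ (introT andP (conj (sqrtr_ge0 _) s1)).
rewrite sqr_sqrtr // => /(_ (lexx _))/andP[+ _]; apply: lt_le_trans.
by rewrite exprn_even_gt0 //= subr_eq0 gt_eqF.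
Qed.

Lemma continuous_circle_sq p q : continuous (circle_sq p q).
Proof.
move=> t; rewrite /circle_sq; apply: cvgD; last exact: cvg_cst.
apply: cvgD; first exact: cvg_cst.
apply: cvgM; first exact: cvg_cst.
by apply: cvgB; apply: cvgM;
  (exact: cvg_cst || exact: continuous_cos || exact: continuous_sin).
Qed.

Lemma continuous_ln_circle_sq p q : p ^+ 2 + q ^+ 2 < 1 ->
  continuous (fun t => ln (circle_sq p q t)).
Proof.
move=> pq1 t; apply: (continuous_comp (@continuous_circle_sq p q t)).
by apply: continuous_ln; exact: circle_sq_gt0.
Qed.

(** This is |1 + w|^2 |1 - w|^2 = |1 - w^2|^2 for w = c e^(it): the angle doubles and c becomes -
    c^2. *)
Lemma circle_sq_double p q t :
  circle_sq p q t * circle_sq p q (t + pi) =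
  circle_sq (q ^+ 2 - p ^+ 2) (- (2 * p * q)) (2 * t).
Proof.
have s2 := sin2cos2 t.
rewrite /circle_sq cosDpi sinDpi (_ : 2 * t = t + t) ?cosD ?sinD; last by ring.
ring: s2.
Qed.

Lemma ln_circle_sq_integral_half p q c : p ^+ 2 + q ^+ 2 < 1 ->
  circle_integral (fun t => ln (circle_sq p q t)) c ->
  circle_integral (fun t => ln (circle_sq (q ^+ 2 - p ^+ 2) (- (2 * p * q)) t)) (2 * c).
Proof.
move=> pq1 [G dG <-].
have pq1' : (q ^+ 2 - p ^+ 2) ^+ 2 + (- (2 * p * q)) ^+ 2 < 1 by nra.
have [G' dG'] := exists_primitive (continuous_ln_circle_sq pq1').
exists G' => //.
pose K t := G t + (G (t + pi) - 2^-1 * G' (2 * t)).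
suff : K 0 = K pi.
  rewrite /K !add0r mulr0 (_ : pi + pi = 2 * pi); last by ring.
  lra.
(* The threshold -1/2 keeps 2 t above -1, where [G'] is known to be a primitive. *)
apply: (@derive0_const K (- 2^-1)) => [||t t1].
- by rewrite oppr_lt0 invr_gt0.
- exact: pi_ge0.
have t1' : -1 < t by rewrite (lt_trans _ t1) // ltrN2 invf_lt1 // ltr1n.
have t1'' : -1 < t + pi by rewrite ltr_wpDr // pi_ge0.
have t2 : -1 < 2 * t by lra.
have d1 := dG _ t1'; have d2 := dG _ t1''; have d3 := dG' _ t2.
have d2' : is_derive t (1 : R) (fun t => G (t + pi)) (ln (circle_sq p q (t + pi))).
  have -> : (fun t => G (t + pi)) = G \o shift pi by [].
  by apply: is_derive_eq; rewrite ?mulr1 ?addr0 // /GRing.scale /=; ring.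
have d3' : is_derive t (1 : R) (fun t => G' (2 * t))
    (2 * ln (circle_sq (q ^+ 2 - p ^+ 2) (- (2 * p * q)) (2 * t))).
  have -> : (fun t => G' (2 * t)) = G' \o (fun t => 2 * t) by [].
  by apply: is_derive_eq; rewrite /GRing.scale /=; ring.
apply: is_derive_eq.
rewrite -circle_sq_double lnM ?posrE ?circle_sq_gt0 // /GRing.scale /=; by field.
Qed.

(** Replacing c by - c^2 doubles the integral and does not increase |c|. As the integrals with |c|
    <= s are bounded by a constant B that depends on s alone, 2^n times the given one is at most B
    in absolute value for every n, so it vanishes. *)
Lemma ln_circle_sq_integral p q : p ^+ 2 + q ^+ 2 < 1 ->
  circle_integral (fun t => ln (circle_sq p q t)) 0.
Proof.
move=> pq1; have [G dG] := exists_primitive (continuous_ln_circle_sq pq1).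
pose s := Num.sqrt (p ^+ 2 + q ^+ 2).
have N0 : 0 <= p ^+ 2 + q ^+ 2 by rewrite addr_ge0 // sqr_ge0.
have s0 : 0 <= s := sqrtr_ge0 _.
have s2 : s ^+ 2 = p ^+ 2 + q ^+ 2 by rewrite sqr_sqrtr.
have s1 : s < 1 by rewrite -sqrtr1 ltr_sqrt.
pose B := 2 * pi * (ln 4 - ln ((1 - s) ^+ 2)).
have bnd p' q' c : p' ^+ 2 + q' ^+ 2 <= s ^+ 2 ->
    circle_integral (fun t => ln (circle_sq p' q' t)) c -> `|c| <= B.
  move=> pqs [H dH <-].
  have pi2 : 0 <= 2 * pi :> R by rewrite mulr_ge0 ?pi_ge0.
  have dH0 (t : R) : 0 <= t -> is_derive t (1 : R) H (ln (circle_sq p' q' t)).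
    by move=> t0; apply: dH; rewrite (lt_le_trans _ t0) // ltrN10.
  have [||z _ ->] := @MVT_segment R H (fun t => ln (circle_sq p' q' t)) 0 (2 * pi) pi2.
  - by move=> t; rewrite in_itv /= => /andP[/ltW/dH0].
  - apply: derivable_within_continuous => t; rewrite in_itv /= => /andP[/dH0 dt _].
    exact: ex_derive.
  - rewrite subr0 normrM (ger0_norm pi2) mulrC /B ler_wpM2l //.
    have s01 : 0 <= s < 1 by rewrite s0.
    have := circle_sq_bounds z s01 pqs => /andP[lo hi].
    have e0 : 0 < (1 - s) ^+ 2 by rewrite exprn_even_gt0 //= subr_eq0 gt_eqF.
    have lo' : ln ((1 - s) ^+ 2) <= ln (circle_sq p' q' z).
      by rewrite ler_ln ?posrE //; exact: lt_le_trans lo.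
    have hi' : ln (circle_sq p' q' z) <= ln 4.
      by rewrite ler_ln ?posrE //; exact: lt_le_trans lo.
    have l4 : 0 <= ln 4 :> R by rewrite ln_ge0 // ler1n.
    have le : ln ((1 - s) ^+ 2) <= 0 by rewrite ln_le0 // exprn_ile1 //; lra.
    by rewrite ler_norml; apply/andP; split; lra.
have iter n : forall p' q' c, p' ^+ 2 + q' ^+ 2 <= s ^+ 2 ->
    circle_integral (fun t => ln (circle_sq p' q' t)) c -> 2 ^+ n * `|c| <= B.
  elim: n => [|n IH] p' q' c pqs Ic; first by rewrite mul1r; exact: bnd Ic.
  have s21 : s ^+ 2 < 1 by rewrite s2.
  have pq1' := le_lt_trans pqs s21.
  have := IH _ _ _ _ (ln_circle_sq_integral_half pq1' Ic).
  rewrite normrM ger0_norm // mulrA -exprSr; apply.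
  have : 0 <= p' ^+ 2 + q' ^+ 2 by rewrite addr_ge0 // sqr_ge0.
  nra.
exists G => //; apply/eqP; rewrite -normr_le0 leNgt; apply/negP => c0.
have [n] : exists n : nat, B / `|G (2 * pi) - G 0| < n%:R.
  by exists (Num.truncn (B / `|G (2 * pi) - G 0|)).+1; exact: truncnS_gt.
rewrite ltr_pdivrMr // => Bn.
have nn : (n%:R : R) <= 2 ^+ n by rewrite -natrX ler_nat ltnW // ltn_expl.
have pqs : p ^+ 2 + q ^+ 2 <= s ^+ 2 by rewrite s2.
have := iter n p q _ pqs (ex_intro2 _ _ G dG erefl).
by apply/negP; rewrite -ltNge (lt_le_trans Bn) // ler_wpM2r.
Qed.

End CircleIntegral.

(** * Mean values of the logarithm of the modulus of a polynomial *)

Section CircleMean.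
Context {R : realType}.
Implicit Types (f g : R -> R) (c d k r : R) (w z a b : R[i]).
Local Notation normc := Normc.normc.
Local Open Scope complex_scope.

Definition circle_mean f c := continuous f /\ circle_integral f (2 * pi * c).

Lemma circle_mean_eq f g c : f =1 g -> circle_mean f c -> circle_mean g c.
Proof. by move=> /funext ->. Qed.

Lemma circle_meanD f g c d : circle_mean f c -> circle_mean g d ->
  circle_mean (fun t => f t + g t) (c + d).
Proof.
move=> [cf If] [cg Ig]; split; first by move=> t; apply: cvgD; [exact: cf|exact: cg].
by rewrite mulrDr; exact: circle_integralD.
Qed.

Lemma circle_meanZ k f c : circle_mean f c -> circle_mean (fun t => k * f t) (k * c).
Proof.
move=> [cf If]; split; first by move=> t; apply: cvgM; [exact: cvg_cst|exact: cf].
by rewrite mulrCA; exact: circle_integralZ.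
Qed.

Lemma circle_mean_cst k : circle_mean (fun=> k) k.
Proof. by split; [move=> t; exact: cvg_cst|exact: circle_integral_cst]. Qed.

Lemma cos_circle_mean : circle_mean (@cos R) 0.
Proof. by split; [exact: continuous_cos|rewrite mulr0; exact: cos_circle_integral]. Qed.

Lemma cos2_circle_mean : circle_mean (fun t => cos t ^+ 2 - sin t ^+ 2) 0.
Proof.
split; last by rewrite mulr0; exact: cos2_circle_integral.
by move=> t; apply: cvgB; rewrite /GRing.exp /=; apply: cvgM;
  (exact: continuous_cos || exact: continuous_sin).
Qed.

Lemma sin2_circle_mean : circle_mean (fun t => sin t * cos t) 0.
Proof.
split; last by rewrite mulr0; exact: sin2_circle_integral.
by move=> t; apply: cvgM; [exact: continuous_sin|exact: continuous_cos].
Qed.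

Lemma circle_meanE f c : circle_mean f c ->
  (((2 * pi)^-1)%:E * \int[@lebesgue_measure R]_(t in `[0%R, (2 * pi)%R]) (f t)%:E = c%:E)%E.
Proof.
move=> [cf If]; rewrite (circle_integralE cf If) -EFinM mulrA mulVf ?mul1r //.
by rewrite mulf_neq0 // gt_eqF // pi_gt0.
Qed.

Lemma sqr_normc z : normc z ^+ 2 = complex.Re z ^+ 2 + complex.Im z ^+ 2.
Proof. by case: z => x y /=; rewrite sqr_sqrtr // addr_ge0 // sqr_ge0. Qed.

Lemma normc_ge0 z : 0 <= normc z.
Proof. by case: z => x y; exact: sqrtr_ge0. Qed.

Lemma normc_gt0 z : (0 < normc z) = (z != 0).
Proof.
rewrite lt0r normc_ge0 andbT; congr (~~ _); apply/eqP/eqP => [|->].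
  exact: Normc.eq0_normc.
exact: Normc.normc0.
Qed.

Lemma normc_opp z : normc (- z) = normc z.
Proof. exact: normcN. Qed.

Lemma ler_normc_add w z : normc (w + z) <= normc w + normc z.
Proof. exact: le_normcD. Qed.

(** Factor out w: what remains is |1 + c e^(it)| with c = r / w and |c| < 1, whose logarithm has
    mean 0. *)
Lemma ln_normc_circle_mean w r : 0 <= r < normc w ->
  circle_mean (fun t => ln (normc (w + r%:C * (cos t +i* sin t)))) (ln (normc w)).
Proof.
move=> /andP[r0 rw]; have w0 : 0 < normc w := le_lt_trans r0 rw.
have wn0 : w != 0 by rewrite -normc_gt0.
pose c := r%:C / w; pose p := complex.Re c; pose q := complex.Im c.
have cE : p ^+ 2 + q ^+ 2 = (r / normc w) ^+ 2.
  by rewrite -sqr_normc Normc.normcM Normc.normcV /= expr0n addr0 sqrtr_sqr ger0_norm.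
have pq1 : p ^+ 2 + q ^+ 2 < 1.
  by rewrite cE expr_lt1 // ?divr_ge0 ?normc_ge0 // ltr_pdivrMr // mul1r.
apply: (@circle_mean_eq (fun t => ln (normc w) + 2^-1 * ln (circle_sq p q t))) => [t|].
  have -> : w + r%:C * (cos t +i* sin t) = w * (1 + (p +i* q) * (cos t +i* sin t)).
    have -> : p +i* q = r%:C / w by rewrite /p /q /c; case: (r%:C / w).
    by rewrite mulrDr mulr1 !mulrA (mulrC w) mulfK.
  have sq := circle_sq_gt0 t pq1.
  have nE : normc (1 + (p +i* q) * (cos t +i* sin t)) = Num.sqrt (circle_sq p q t).
    congr Num.sqrt; rewrite /circle_sq /=.
    have s2 := sin2cos2 t; ring: s2.
  rewrite Normc.normcM nE lnM ?posrE ?sqrtr_gt0 //; congr (_ + _).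
  rewrite -[X in _ * ln X](sqr_sqrtr (ltW sq)) lnXn ?sqrtr_gt0 //.
  by rewrite -[ln _ *+ 2]mulr_natl mulrA mulVf // mul1r.
have := circle_meanD (circle_mean_cst (ln (normc w)))
  (@circle_meanZ 2^-1 (fun t => ln (circle_sq p q t)) 0 _).
rewrite mulr0 addr0; apply; split; first exact: continuous_ln_circle_sq.
by rewrite mulr0; exact: ln_circle_sq_integral.
Qed.

(** The polynomial splits into linear factors, and the means of their logarithms add up as long as
    the circle stays closer to a than every root. *)
Lemma ln_normc_poly_circle_mean (p : {poly R[i]}) a : p.[a] != 0 ->
  exists2 rho : R, 0 < rho & forall r, 0 <= r < rho ->
    (forall t, p.[a + r%:C * (cos t +i* sin t)] != 0) /\
    circle_mean (fun t => ln (normc p.[a + r%:C * (cos t +i* sin t)])) (ln (normc p.[a])).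
Proof.
have [s ->] := closed_field_poly_normal p; set l := lead_coef p.
have hE x : (l *: \prod_(z <- s) ('X - z%:P)).[x] = l * \prod_(z <- s) (x - z).
  by rewrite hornerZ horner_prod; congr (_ * _); apply: eq_bigr => z _; rewrite !hornerE.
rewrite hE mulf_eq0 negb_or => /andP[l0].
suff: \prod_(z <- s) (a - z) != 0 ->
  exists2 rho : R, 0 < rho & forall r, 0 <= r < rho ->
    (forall t, l * \prod_(z <- s) (a + r%:C * (cos t +i* sin t) - z) != 0) /\
    circle_mean (fun t => ln (normc (l * \prod_(z <- s) (a + r%:C * (cos t +i* sin t) - z))))
      (ln (normc (l * \prod_(z <- s) (a - z)))).
  move=> h /h[rho rho0 H]; exists rho => // r /H[H1 H2]; split => [t|]; first by rewrite hE.
  by apply: (circle_mean_eq _ H2) => t; rewrite hE.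
elim: s {hE} => [_|z s IH].
  exists 1 => // r _; split => [t|]; first by rewrite big_nil mulr1.
  rewrite big_nil; apply: (circle_mean_eq _ (circle_mean_cst _)) => t.
  by rewrite big_nil.
rewrite big_cons mulf_eq0 negb_or => /andP[az sn0].
have [rho rho0 H] := IH sn0.
exists (Num.min rho (normc (a - z))); first by rewrite lt_min rho0 normc_gt0.
move=> r /andP[r0]; rewrite lt_min => /andP[rrho rz].
have [H1 H2] := H r (introT andP (conj r0 rrho)).
have zn0 t : a + r%:C * (cos t +i* sin t) - z != 0.
  apply/eqP => /eqP; rewrite addrAC addr_eq0 => /eqP azE.
  move: rz; rewrite azE normc_opp Normc.normcM /= expr0n addr0 sqrtr_sqr ger0_norm //.
  by rewrite cos2Dsin2 sqrtr1 mulr1 ltxx.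
split => [t|].
  by rewrite big_cons mulrCA mulf_neq0.
rewrite [l * _]mulrCA Normc.normcM lnM ?posrE ?normc_gt0 //; last by rewrite mulf_neq0.
have H3 := @ln_normc_circle_mean (a - z) r (introT andP (conj r0 rz)).
apply: (circle_mean_eq _ (circle_meanD H3 H2)) => t.
rewrite big_cons [l * (_ * _)]mulrCA [in RHS]Normc.normcM lnM ?posrE ?normc_gt0 //.
by rewrite addrAC.
Qed.

End CircleMean.

(** * Lower bounds for the extremal function *)

Section LogModulus.
Context {R : realType}.
Local Notation C := (R[i]^o).
Local Notation normc := Normc.normc.
Local Open Scope complex_scope.

Lemma usc_nearP (X : topologicalType) (u : X -> \bar R) :
  upper_semicontinuous u <->
  forall x (m : R), (u x < m%:E)%E -> \forall y \near x, (u y < m%:E)%E.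
Proof.
split=> [usc x m um|h x a].
  have [|V Vx hV] := usc x (- m); first by rewrite EFinN lteN2.
  by apply: filterS Vx => y /hV; rewrite EFinN lteN2.
have E y : (a%:E < - u y)%E = (u y < (- a)%:E)%E by rewrite EFinN lteNr.
rewrite /= E => /h hx.
by exists [set y | (u y < (- a)%:E)%E] => // y /= hy; rewrite E.
Qed.

Lemma usc_comp (X Y : topologicalType) (f : X -> Y) (u : Y -> \bar R) :
  continuous f -> upper_semicontinuous u -> upper_semicontinuous (u \o f).
Proof.
move=> cf /usc_nearP usc; apply/usc_nearP => x m um.
exact: (cf x _ (usc _ _ um)).
Qed.

Lemma continuous_to_mx (X Y : topologicalType) m n (f : X -> 'M[Y]_(m, n)) :
  (forall i j, continuous (fun x => f x i j)) -> continuous f.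
Proof.
move=> cf x A [P hP PA].
have : \forall y \near x, forall ij : 'I_m * 'I_n, P ij.1 ij.2 (f y ij.1 ij.2).
  apply: filter_forall => -[i j] /=; exact: (cf i j x _ (hP i j)).
by apply: filterS => y hy; apply: PA => i j; exact: (hy (i, j)).
Qed.

Lemma continuous_mx_coord (X : topologicalType) m n i j :
  continuous (fun M : 'M[X]_(m, n) => M i j).
Proof.
move=> M A MA; exists (fun i' j' => if (i' == i) && (j' == j) then A else setT).
  by move=> i' j'; case: ifPn => [/andP[/eqP -> /eqP ->] //|_]; exact: filterT.
by move=> N /= /(_ i j); rewrite !eqxx.
Qed.

Lemma continuous_addC (X : topologicalType) (f g : X -> C) :
  continuous f -> continuous g -> continuous (fun z => f z + g z).
Proof.
move=> cf cg z; apply: (@cvgD R[i] C _ (nbhs z) (nbhs_filter z) f g).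
- exact: cf.
- exact: cg.
Qed.

Lemma continuous_mulC (X : topologicalType) (f g : X -> C) :
  continuous f -> continuous g -> continuous (fun z => f z * g z : C).
Proof.
move=> cf cg z; apply: (@cvgM R[i] _ (nbhs z) (nbhs_filter z) f g).
- exact: cf.
- exact: cg.
Qed.

(** Balls of [C] have radii in R[i]; a positive element there has imaginary part 0, so real radii
    suffice. *)
Lemma nearC (z : C) (P : C -> Prop) :
  (\forall w \near z, P w) <-> exists2 e : R, 0 < e & forall w, normc (z - w) < e -> P w.
Proof.
split=> [/nbhs_ballP[[e e'] /= /andP[/eqP e'0 e0] h]|[e e0 h]].
  exists e => // w zw; apply: h; rewrite /ball /= ltcE /= zw andbT.
  by rewrite -e'0.
apply/nbhs_ballP; exists e%:C => /=; first by rewrite ltcR.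
by move=> w; rewrite /ball /= ltcR; exact: h.
Qed.

Lemma continuous_normc : continuous (@Normc.normc R : C -> R).
Proof.
move=> z; apply/(@cvgrPdist_lt _ R _ (nbhs z) (nbhs_filter z)) => e e0.
apply/nearC; exists e => // w.
apply: le_lt_trans; rewrite ler_norml.
have h1 := ler_normc_add (z - w) w; have h2 := ler_normc_add (w - z) z.
move: h1 h2; rewrite !subrK -[w - z]opprB normc_opp => h1 h2.
by apply/andP; split; lra.
Qed.

(** The value [ln 0] is 0 by convention, whereas a logarithmic potential has to be -oo at the
    zeros. *)
Definition loge (x : R) : \bar R := if x == 0 then -oo%E else (ln x)%:E.

Lemma loge_lt (k : R) x m : 0 < k -> 0 <= x ->
  ((k^-1)%:E * loge x < m%:E)%E = (x < expR (k * m)).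
Proof.
move=> k0 x0; rewrite /loge; case: eqP => [->|/eqP xn0].
  by rewrite gt0_muleNy ?lte_fin ?invr_gt0 // ltNyr expR_gt0.
have xp : 0 < x by rewrite lt0r xn0.
rewrite -EFinM lte_fin mulrC ltr_pdivrMr // [m * k]mulrC.
by rewrite -[in RHS](lnK (x := x)) ?posrE // ltr_expR.
Qed.

Lemma loge_le (k : R) x m : 0 < k -> 0 <= x ->
  ((k^-1)%:E * loge x <= m%:E)%E = (x <= expR (k * m)).
Proof.
move=> k0 x0; rewrite /loge; case: eqP => [->|/eqP xn0].
  by rewrite gt0_muleNy ?lte_fin ?invr_gt0 // leNye expR_ge0.
have xp : 0 < x by rewrite lt0r xn0.
rewrite -EFinM lee_fin mulrC ler_pdivrMr // [m * k]mulrC.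
by rewrite -[in RHS](lnK (x := x)) ?posrE // ler_expR.
Qed.

(** Exactly what plurisubharmonicity of log |P| asks for: continuity, and a one-variable polynomial
    on each complex line. The degree enters only later, as a growth bound. *)
Definition polynomial_fun d (P : 'rV[C]_d -> C) :=
  continuous P /\
  forall a b, exists p : {poly R[i]}, forall l : C, P (a + l *: b) = p.[l].

Lemma polynomial_fun_cst d c : @polynomial_fun d (fun=> c).
Proof.
by split=> [|a b]; [exact: cst_continuous|exists c%:P => l; rewrite hornerC].
Qed.

Lemma polynomial_fun_coord d i : @polynomial_fun d (fun z => z 0 i).
Proof.
split=> [|a b]; first exact: continuous_mx_coord.
by exists ((a 0 i)%:P + 'X * (b 0 i)%:P) => l; rewrite !mxE !hornerE.
Qed.

Lemma polynomial_funD d (P Q : 'rV[C]_d -> C) :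
  polynomial_fun P -> polynomial_fun Q -> polynomial_fun (fun z => P z + Q z).
Proof.
move=> [cP hP] [cQ hQ]; split=> [|a b]; first exact: continuous_addC.
have [p hp] := hP a b; have [q hq] := hQ a b.
by exists (p + q) => l; rewrite hp hq hornerD.
Qed.

Lemma polynomial_funM d (P Q : 'rV[C]_d -> C) :
  polynomial_fun P -> polynomial_fun Q -> polynomial_fun (fun z => P z * Q z).
Proof.
move=> [cP hP] [cQ hQ]; split=> [|a b]; first exact: continuous_mulC.
have [p hp] := hP a b; have [q hq] := hQ a b.
by exists (p * q) => l; rewrite hp hq hornerM.
Qed.

Lemma continuous_line d (a b : 'rV[C]_d) : continuous (fun l : C => a + l *: b).
Proof.
apply: continuous_to_mx => i j.
under eq_fun do rewrite !mxE.
apply: continuous_addC; first exact: cst_continuous.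
by apply: continuous_mulC; [by move=> ?; exact: cvg_id|exact: cst_continuous].
Qed.

Lemma enorm_ge0 d (z : 'rV[C]_d) : 0 <= enorm z.
Proof. exact: sqrtr_ge0. Qed.

Lemma log_modulus_lelong d (P : 'rV[C]_d -> C) k (c : R) :
  polynomial_fun P -> (0 < k)%N -> 0 < c ->
  (forall z, normc (P z) <= (c * (1 + enorm z)) ^+ k) ->
  lelong (fun z => ((k%:R^-1)%:E * loge (normc (P z)))%E).
Proof.
move=> [cP hP] k0 c0 bP.
have k0' : 0 < k%:R :> R by rewrite ltr0n.
have usc : upper_semicontinuous (fun z => ((k%:R^-1)%:E * loge (normc (P z)))%E).
  apply/usc_nearP => z m; rewrite loge_lt ?normc_ge0 // => Pm.
  have cN : {for z, continuous (fun z => normc (P z))}.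
    exact: (continuous_comp (cP z) (@continuous_normc (P z))).
  have near_lt : \forall y \near z, normc (P y) < expR (k%:R * m).
    exact: (cvgr_lt _ cN _ Pm).
  apply: filterS near_lt => y.
  by rewrite loge_lt ?normc_ge0.
have fin z : ((k%:R^-1)%:E * loge (normc (P z)) < +oo)%E.
  rewrite /loge; case: ifP => _; last by rewrite -EFinM ltry.
  by rewrite gt0_muleNy ?lte_fin ?invr_gt0.
split; last first.
  exists (ln c) => z.
  have e1 : 0 < 1 + enorm z by rewrite ltr_pwDl ?enorm_ge0.
  rewrite loge_le ?normc_ge0 // (le_trans (bP z)) //.
  by rewrite expRM_natl expRD !lnK ?posrE // mulrC.
split=> // a b; split=> [l||l0]; first exact: fin.
  exact: (usc_comp (@continuous_line _ a b) usc).
have [p hp] := hP a b.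
(* At a zero the left-hand side is -oo; elsewhere the mean value property holds with equality on
   small circles. *)
have [p0|pn0] := eqVneq p.[l0] 0.
  exists 1 => // r _.
  by rewrite hp p0 Normc.normc0 /loge eqxx gt0_muleNy ?leNye // lte_fin invr_gt0.
have [rho rho0 H] := ln_normc_poly_circle_mean pn0.
exists rho => // r /H[rn0 /(circle_meanZ k%:R^-1)/circle_meanE E].
rewrite hp /loge gt_eqF ?normc_gt0 // -EFinM -E.
rewrite le_eqVlt; apply/orP; left; apply/eqP; congr (_ * _)%E.
apply: eq_integral => t _.
by rewrite hp gt_eqF ?normc_gt0 ?rn0 // -EFinM.
Qed.

End LogModulus.

(** * Polynomials obtained by averaging over signs of square roots *)

Section SimplexLowerBound.
Context {R : realType}.
Local Notation C := (R[i]^o).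
Local Notation normc := Normc.normc.
Local Open Scope complex_scope.

Lemma expr_unbounded (x B : R) : 1 < x -> exists k : nat, B < x ^+ k.
Proof.
move=> x1; have h0 : 0 < x - 1 by rewrite subr_gt0.
have bern k : 1 + k%:R * (x - 1) <= x ^+ k.
  elim: k => [|k IH]; first by rewrite mul0r addr0.
  rewrite exprSr -natr1 mulrDl mul1r.
  have k0 : 0 <= k%:R * (x - 1) by rewrite mulr_ge0 // ltW.
  nra.
exists (Num.truncn (B / (x - 1))).+1; apply: lt_le_trans (bern _).
by rewrite ltr_wpDl // -ltr_pdivrMr // truncnS_gt.
Qed.

Lemma normc_sum I (r : seq I) (F : I -> R[i]) :
  normc (\sum_(i <- r) F i) <= \sum_(i <- r) normc (F i).
Proof.
elim: r => [|i r IH]; first by rewrite !big_nil Normc.normc0.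
by rewrite !big_cons (le_trans (ler_normc_add _ _)) // lerD2l.
Qed.

Lemma normcX (z : R[i]) n : normc (z ^+ n) = normc z ^+ n.
Proof.
by elim: n => [|n IH]; rewrite ?expr0 ?Normc.normc1 // !exprS Normc.normcM IH.
Qed.

(* A linear recurrence with characteristic polynomial vanishing at the other
   values isolates the powers of [theta]. *)
Lemma power_sum_bound (s : seq R[i]) (rho M : R) (theta : R[i]) :
  0 < rho -> theta \in s ->
  (forall k, (0 < k)%N -> normc (\sum_(x <- s) x ^+ k) <= M * rho ^+ k) ->
  normc theta <= rho.
Proof.
move=> rho0 ths bnd; rewrite leNgt; apply/negP => lt.
pose Q : {poly R[i]} := \prod_(x <- s | x != theta) ('X - x%:P).
have Qth : Q.[theta] != 0.
  rewrite horner_prod prodf_seq_neq0; apply/allP => x _; apply/implyP => xth.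
  by rewrite hornerXsubC subr_eq0 eq_sym.
have Q0 x : x \in s -> x != theta -> Q.[x] = 0.
  move=> xs xth; rewrite horner_prod; apply/eqP; rewrite prodf_seq_eq0.
  by apply/hasP; exists x => //; rewrite xth hornerXsubC subrr eqxx.
(* Combining consecutive power sums with the coefficients of [Q] kills every value except [theta],
   which survives with its multiplicity. Exponents start at k + 1 because only positive ones are
   bounded by hypothesis. *)
have iso k : \sum_(i < size Q) Q`_i * (\sum_(x <- s) x ^+ (k.+1 + i)) =
    theta ^+ k.+1 * Q.[theta] *+ count (pred1 theta) s.
  under eq_bigr do rewrite mulr_sumr.
  rewrite exchange_big /=.
  have E x : \sum_(i < size Q) Q`_i * x ^+ (k.+1 + i) = x ^+ k.+1 * Q.[x].
    rewrite horner_coef mulr_sumr; apply: eq_bigr => i _.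
    by rewrite exprD mulrCA.
  under eq_bigr do rewrite E.
  rewrite (eq_big_seq (fun x => if x == theta then theta ^+ k.+1 * Q.[theta] else 0)).
    by rewrite -big_mkcond big_const_seq iter_addr_0.
  by move=> x xs /=; case: eqVneq => [-> //|xth]; rewrite Q0 ?mulr0.
have cnt : (0 < count (pred1 theta) s)%N by rewrite -has_count has_pred1.
pose K := \sum_(i < size Q) normc Q`_i * (M * rho ^+ i).
pose q := normc Q.[theta].
have q0 : 0 < q by rewrite normc_gt0.
have th0 : 0 < normc theta := lt_trans rho0 lt.
have main k : normc theta ^+ k.+1 * q <= rho ^+ k.+1 * K.
  rewrite -normcX -Normc.normcM.
  have le1 : normc (theta ^+ k.+1 * Q.[theta]) <=
      normc (theta ^+ k.+1 * Q.[theta] *+ count (pred1 theta) s).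
    by rewrite normcMn -mulr_natr ler_peMr ?normc_ge0 // ler1n.
  apply: (le_trans le1); rewrite -iso (le_trans (normc_sum _ _)) // mulr_sumr.
  apply: ler_sum => i _; rewrite Normc.normcM mulrCA ler_wpM2l ?normc_ge0 //.
  by rewrite (le_trans (bnd _ _)) // exprD mulrCA.
have [|k] := @expr_unbounded (normc theta / rho) (K / q).
  by rewrite ltr_pdivlMr // mul1r.
apply/negP; rewrite -leNgt.
have x1 : 1 <= normc theta / rho by rewrite ler_pdivlMr // mul1r ltW.
rewrite (le_trans (_ : _ <= (normc theta / rho) ^+ k.+1)) //.
  by rewrite exprSr ler_peMr // exprn_ge0 // (le_trans _ x1).
by rewrite ler_pdivlMr // expr_div_n mulrAC ler_pdivrMr ?exprn_gt0 // [K * _]mulrC main.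
Qed.

(* The coordinates of (a0 s0 + a1 s1 + a2 s2)^(2k) on 1, s0 s1, s0 s2, s1 s2,
   where si^2 = xi. *)
Fixpoint root_power (a0 a1 a2 x0 x1 x2 : R[i]) k : R[i] * R[i] * R[i] * R[i] :=
  if k is k'.+1 then
    let: (p, q, r, s) := root_power a0 a1 a2 x0 x1 x2 k' in
    let al := a0 ^+ 2 * x0 + a1 ^+ 2 * x1 + a2 ^+ 2 * x2 in
    let be := 2 * a0 * a1 in let ga := 2 * a0 * a2 in let de := 2 * a1 * a2 in
    (al * p + be * (x0 * x1) * q + ga * (x0 * x2) * r + de * (x1 * x2) * s,
     al * q + be * p + ga * x2 * s + de * x2 * r,
     al * r + ga * p + be * x1 * s + de * x1 * q,
     al * s + de * p + be * x0 * r + ga * x0 * q)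
  else (1, 0, 0, 0).

Lemma root_powerE (a0 a1 a2 x0 x1 x2 s0 s1 s2 : R[i]) k :
  s0 ^+ 2 = x0 -> s1 ^+ 2 = x1 -> s2 ^+ 2 = x2 ->
  let: (p, q, r, s) := root_power a0 a1 a2 x0 x1 x2 k in
  p + q * (s0 * s1) + r * (s0 * s2) + s * (s1 * s2) =
  ((a0 * s0 + a1 * s1 + a2 * s2) ^+ 2) ^+ k.
Proof.
move=> <- <- <-; elim: k => [|k]; first by rewrite /= expr0; ring.
rewrite [root_power _ _ _ _ _ _ k.+1]/=.
case: (root_power _ _ _ _ _ _ k) => [[[p q] r] s] IH.
by rewrite (exprS _ k) -IH; ring.
Qed.

(* Averaging over the signs of the square roots leaves the coordinate on 1. *)
Lemma root_power_sum (a0 a1 a2 x0 x1 x2 s0 s1 s2 : R[i]) k :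
  s0 ^+ 2 = x0 -> s1 ^+ 2 = x1 -> s2 ^+ 2 = x2 ->
  (root_power a0 a1 a2 x0 x1 x2 k).1.1.1 *+ 4 =
  \sum_(x <- [:: (a0 * s0 + a1 * s1 + a2 * s2) ^+ 2;
                 (a0 * - s0 + a1 * s1 + a2 * s2) ^+ 2;
                 (a0 * s0 + a1 * - s1 + a2 * s2) ^+ 2;
                 (a0 * s0 + a1 * s1 + a2 * - s2) ^+ 2]) x ^+ k.
Proof.
move=> e0 e1 e2; rewrite !big_cons big_nil addr0.
have e0' : (- s0) ^+ 2 = x0 by rewrite sqrrN.
have e1' : (- s1) ^+ 2 = x1 by rewrite sqrrN.
have e2' : (- s2) ^+ 2 = x2 by rewrite sqrrN.
have := root_powerE a0 a1 a2 k e0 e1 e2.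
have := root_powerE a0 a1 a2 k e0' e1 e2.
have := root_powerE a0 a1 a2 k e0 e1' e2.
have := root_powerE a0 a1 a2 k e0 e1 e2'.
case: (root_power _ _ _ _ _ _ k) => [[[p q] r] s] <- <- <- <- /=.
by ring.
Qed.

(** The coordinate on 1 is the mean of four k-th powers, one for each choice of signs up to a global
    sign, each of modulus at most B^k. *)
Lemma normc_root_power (a0 a1 a2 x0 x1 x2 : R[i]) (B : R) k :
  (forall s0 s1 s2, s0 ^+ 2 = x0 -> s1 ^+ 2 = x1 -> s2 ^+ 2 = x2 ->
     normc (a0 * s0 + a1 * s1 + a2 * s2) ^+ 2 <= B) ->
  normc (root_power a0 a1 a2 x0 x1 x2 k).1.1.1 <= B ^+ k.
Proof.
move=> bnd; have [e0 e1 e2] := And3 (sqr_sqrtc x0) (sqr_sqrtc x1) (sqr_sqrtc x2).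
move: (sqrtc x0) (sqrtc x1) (sqrtc x2) e0 e1 e2 => s0 s1 s2 e0 e1 e2.
have B' t0 t1 t2 : t0 ^+ 2 = x0 -> t1 ^+ 2 = x1 -> t2 ^+ 2 = x2 ->
    normc (((a0 * t0 + a1 * t1 + a2 * t2) ^+ 2) ^+ k) <= B ^+ k.
  move=> f0 f1 f2; rewrite normcX normcX lerXn2r ?nnegrE ?exprn_ge0 ?normc_ge0 //;
    last exact: bnd.
  by apply: le_trans (bnd _ _ _ f0 f1 f2); rewrite exprn_ge0 // normc_ge0.
rewrite -(@ler_pMn2r _ 4) // -normcMn (root_power_sum _ _ _ _ e0 e1 e2).
rewrite (le_trans (normc_sum _ _)) // !big_cons big_nil addr0.
have h1 := B' _ _ _ e0 e1 e2.
have h2 : _ <= B ^+ k := B' (- s0) s1 s2 _ e1 e2.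
have h3 : _ <= B ^+ k := B' s0 (- s1) s2 e0 _ e2.
have h4 : _ <= B ^+ k := B' s0 s1 (- s2) e0 e1 _.
rewrite -[leRHS]mulr_natr.
have := h1; have := h2 _; have := h3 _; have := h4 _.
rewrite !sqrrN e0 e1 e2 => /(_ erefl) ? /(_ erefl) ? /(_ erefl) ? ?.
lra.
Qed.

Lemma polynomial_fun_sum4 d (f1 f2 f3 f4 g1 g2 g3 g4 h : 'rV[C]_d -> C) :
  polynomial_fun f1 -> polynomial_fun f2 -> polynomial_fun f3 -> polynomial_fun f4 ->
  polynomial_fun g1 -> polynomial_fun g2 -> polynomial_fun g3 -> polynomial_fun g4 ->
  (forall z, h z = f1 z * g1 z + f2 z * g2 z + f3 z * g3 z + f4 z * g4 z) ->
  polynomial_fun h.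
Proof.
move=> F1 F2 F3 F4 G1 G2 G3 G4 /funext ->.
have M1 := polynomial_funM F1 G1; have M2 := polynomial_funM F2 G2.
have M3 := polynomial_funM F3 G3; have M4 := polynomial_funM F4 G4.
exact: (polynomial_funD (polynomial_funD (polynomial_funD M1 M2) M3) M4).
Qed.

Lemma polynomial_root_power d (a0 a1 a2 : R[i]) (l0 l1 l2 : 'rV[C]_d -> C) k :
  polynomial_fun l0 -> polynomial_fun l1 -> polynomial_fun l2 ->
  polynomial_fun (fun z => (root_power a0 a1 a2 (l0 z) (l1 z) (l2 z) k).1.1.1 : C).
Proof.
move=> P0 P1 P2.
pose f k z := root_power a0 a1 a2 (l0 z) (l1 z) (l2 z) k.
(* The recursion mixes the four coordinates, so the induction has to carry all of them. *)
suff [] : [/\ polynomial_fun (fun z => (f k z).1.1.1 : C),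
  polynomial_fun (fun z => (f k z).1.1.2 : C),
  polynomial_fun (fun z => (f k z).1.2 : C) &
  polynomial_fun (fun z => (f k z).2 : C)] by [].
have fS n z : f n.+1 z = let: (p, q, r, s) := f n z in _ := erefl _.
elim: k => [|k].
  by split; exact: polynomial_fun_cst.
move: (f k) (f k.+1) (fS k) => {f fS} g g' gS [Pp Pq Pr Ps].
have K c : polynomial_fun (fun=> c : C) := @polynomial_fun_cst R d c.
have Z := K 0.
have A : polynomial_fun (fun z => a0 ^+ 2 * l0 z + a1 ^+ 2 * l1 z + a2 ^+ 2 * l2 z : C).
  apply: (polynomial_fun_sum4 (K (a0 ^+ 2)) (K (a1 ^+ 2)) (K (a2 ^+ 2)) Z P0 P1 P2 Z) => z.
  by rewrite mul0r addr0.
have K0 c := polynomial_funM (K c) P0; have K1 c := polynomial_funM (K c) P1.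
have K2 c := polynomial_funM (K c) P2.
have K01 c := polynomial_funM (K c) (polynomial_funM P0 P1).
have K02 c := polynomial_funM (K c) (polynomial_funM P0 P2).
have K12 c := polynomial_funM (K c) (polynomial_funM P1 P2).
split.
- apply: (polynomial_fun_sum4 A (K01 (2 * a0 * a1)) (K02 (2 * a0 * a2)) (K12 (2 * a1 * a2))
    Pp Pq Pr Ps) => z; by rewrite gS; case: (g z) => [[[]]].
- apply: (polynomial_fun_sum4 A (K (2 * a0 * a1)) (K2 (2 * a0 * a2)) (K2 (2 * a1 * a2))
    Pq Pp Ps Pr) => z; by rewrite gS; case: (g z) => [[[]]].
- apply: (polynomial_fun_sum4 A (K (2 * a0 * a2)) (K1 (2 * a0 * a1)) (K1 (2 * a1 * a2))
    Pr Pp Ps Pq) => z; by rewrite gS; case: (g z) => [[[]]].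
- apply: (polynomial_fun_sum4 A (K (2 * a1 * a2)) (K0 (2 * a0 * a1)) (K0 (2 * a0 * a2))
    Ps Pp Pr Pq) => z; by rewrite gS; case: (g z) => [[[]]].
Qed.

Lemma sqr_real_complex (s : R[i]) (t : R) : s ^+ 2 = (t ^+ 2)%:C ->
  exists2 t' : R, s = t'%:C & t' ^+ 2 = t ^+ 2.
Proof.
rewrite rmorphXn /= => /eqP; rewrite eqf_sqr => /orP[/eqP ->|/eqP ->].
  by exists t.
by exists (- t); [rewrite rmorphN|rewrite sqrrN].
Qed.

(** Each (1/k) log |P_k| is a competitor for V_E. A value of V_E(z) below ln |a.s|^2 would bound the
    k-th power sums of the four branches by 4 e^(vk) for some v < ln |a.s|^2, which forces every
    branch, in particular (a.s)^2, to have modulus at most e^v. *)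
Lemma siciak_ge_roots d (E : set 'rV[C]_d) (l0 l1 l2 : 'rV[C]_d -> C) c
    (a0 a1 a2 s0 s1 s2 : R[i]) z :
  polynomial_fun l0 -> polynomial_fun l1 -> polynomial_fun l2 -> 0 < c ->
  (forall w, [/\ normc (l0 w) <= c * (1 + enorm w), normc (l1 w) <= c * (1 + enorm w) &
    normc (l2 w) <= c * (1 + enorm w)]) ->
  (forall w, E w -> exists t0 t1 t2 : R, [/\ l0 w = (t0 ^+ 2)%:C, l1 w = (t1 ^+ 2)%:C,
    l2 w = (t2 ^+ 2)%:C & t0 ^+ 2 + t1 ^+ 2 + t2 ^+ 2 = 1]) ->
  (forall t0 t1 t2 : R, t0 ^+ 2 + t1 ^+ 2 + t2 ^+ 2 = 1 ->
    normc (a0 * t0%:C + a1 * t1%:C + a2 * t2%:C) <= 1) ->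
  s0 ^+ 2 = l0 z -> s1 ^+ 2 = l1 z -> s2 ^+ 2 = l2 z ->
  0 < normc (a0 * s0 + a1 * s1 + a2 * s2) ->
  ((ln (normc (a0 * s0 + a1 * s1 + a2 * s2) ^+ 2))%:E <= siciak E z)%E.
Proof.
move=> P0 P1 P2 c0 lgrowth lE aunit e0 e1 e2 sigma0.
set sg := a0 * s0 + a1 * s1 + a2 * s2 in sigma0 *.
pose P k w : C := (root_power a0 a1 a2 (l0 w) (l1 w) (l2 w) k).1.1.1.
pose A := normc a0 + normc a1 + normc a2 + 1.
have A0 : 0 < A by rewrite ltr_wpDl // !addr_ge0 // normc_ge0.
(* Any square root of any l_i(w) has modulus at most sqrt (c (1 + |w|)), whence |a.s|^2 <= A^2 c (1
   + |w|). The summand 1 in [A] makes it positive even for a = 0. *)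
have Pgrowth k w : normc (P k w) <= (A ^+ 2 * c * (1 + enorm w)) ^+ k.
  have ce : 0 <= c * (1 + enorm w) by rewrite mulr_ge0 ?ltW // ltr_pwDl // enorm_ge0.
  have [g0 g1 g2] := lgrowth w.
  apply: normc_root_power => r0 r1 r2 f0 f1 f2.
  pose q := Num.sqrt (c * (1 + enorm w)).
  have rq r x : r ^+ 2 = x -> normc x <= c * (1 + enorm w) -> normc r <= q.
    move=> <-; rewrite normcX => h.
    by rewrite -(ger0_norm (normc_ge0 r)) -sqrtr_sqr ler_sqrt.
  have h0 := rq _ _ f0 g0; have h1 := rq _ _ f1 g1; have h2 := rq _ _ f2 g2.
  have q0 : 0 <= q := sqrtr_ge0 _.
  rewrite -mulrA -(sqr_sqrtr ce) -/q -exprMn lerXn2r ?nnegrE ?normc_ge0 //.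
    by rewrite mulr_ge0 // ltW.
  rewrite (le_trans (ler_normc_add _ _)) // /A !mulrDl mul1r -[leLHS]addr0 lerD //.
  rewrite lerD // ?Normc.normcM ?ler_wpM2l ?normc_ge0 //.
  rewrite (le_trans (ler_normc_add _ _)) // !Normc.normcM.
  by rewrite lerD // ler_wpM2l ?normc_ge0.
have PE k w : E w -> normc (P k w) <= 1.
  move=> /lE[t0 [t1 [t2 [q0 q1 q2 tt]]]].
  rewrite -[leRHS](expr1n _ k); apply: normc_root_power => r0 r1 r2.
  rewrite q0 q1 q2 => /sqr_real_complex[t0' -> u0] /sqr_real_complex[t1' -> u1].
  move=> /sqr_real_complex[t2' -> u2].
  by rewrite expr_le1 ?normc_ge0 // aunit // u0 u1 u2.
have Ple k : (0 < k)%N -> ((k%:R^-1)%:E * loge (normc (P k z)) <= siciak E z)%E.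
  move=> k0; apply: ereal_sup_ubound.
  exists (fun w => ((k%:R^-1)%:E * loge (normc (P k w)))%E) => //; split.
    apply: (@log_modulus_lelong _ _ _ _ (A ^+ 2 * c)) => //.
      exact: polynomial_root_power.
    by rewrite mulr_gt0 // exprn_gt0.
  move=> w /(PE k) Pw; rewrite loge_le ?ltr0n ?normc_ge0 //.
  by rewrite mulr0 expR0.
rewrite leNgt; apply/negP => lt.
(* A real v is needed even if the supremum is -oo. *)
have [v vlt sv] : exists2 v, v < ln (normc sg ^+ 2) & (siciak E z <= v%:E)%E.
  case: (siciak E z) lt => [r| |] //; first by rewrite lte_fin; exists r.
  by exists (ln (normc sg ^+ 2) - 1); rewrite ?leNye // ltrBlDr ltrDl.
have := @power_sum_bound [:: sg ^+ 2; (a0 * - s0 + a1 * s1 + a2 * s2) ^+ 2;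
  (a0 * s0 + a1 * - s1 + a2 * s2) ^+ 2; (a0 * s0 + a1 * s1 + a2 * - s2) ^+ 2]
  (expR v) 4 (sg ^+ 2) (expR_gt0 _).
have sg2 : 0 < normc sg ^+ 2 by rewrite exprn_gt0.
rewrite inE eqxx normcX leNgt -[X in _ < X]lnK ?posrE // ltr_expR vlt.
move=> /(_ isT) absurd; suff: false by []; apply: absurd => k k0.
rewrite -(root_power_sum _ _ _ k e0 e1 e2) normcMn.
rewrite -[leLHS]mulr_natl ler_pM2l ?ltr0n // -expRM_natl.
by rewrite -loge_le ?normc_ge0 ?ltr0n // (le_trans (Ple k k0)).
Qed.

End SimplexLowerBound.

(** * The optimal coefficient vector and the explicit lower bound *)

Section SimplexLowerBoundExplicit.
Context {R : realType}.
Local Notation C := (R[i]^o).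
Local Notation normc := Normc.normc.
Local Open Scope complex_scope.

Lemma complex_eq (z w : R[i]) : complex.Re z = complex.Re w ->
  complex.Im z = complex.Im w -> z = w.
Proof. by case: z w => [a b] [c e] /= -> ->. Qed.

(** Bessel's inequality, from |t - p u - q v|^2 >= 0. The vector v is only required to have length
    at most 1, so that v = 0 is covered. *)
Lemma bessel3 (u0 u1 u2 v0 v1 v2 t0 t1 t2 : R) :
  u0 ^+ 2 + u1 ^+ 2 + u2 ^+ 2 = 1 -> v0 ^+ 2 + v1 ^+ 2 + v2 ^+ 2 <= 1 ->
  u0 * v0 + u1 * v1 + u2 * v2 = 0 -> t0 ^+ 2 + t1 ^+ 2 + t2 ^+ 2 = 1 ->
  (u0 * t0 + u1 * t1 + u2 * t2) ^+ 2 + (v0 * t0 + v1 * t1 + v2 * t2) ^+ 2 <= 1.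
Proof.
move=> u1E v1E uv t1E.
set p := u0 * t0 + u1 * t1 + u2 * t2; set q := v0 * t0 + v1 * t1 + v2 * t2.
have : 0 <= (t0 - p * u0 - q * v0) ^+ 2 + (t1 - p * u1 - q * v1) ^+ 2 +
    (t2 - p * u2 - q * v2) ^+ 2 by rewrite !addr_ge0 // sqr_ge0.
have -> : (t0 - p * u0 - q * v0) ^+ 2 + (t1 - p * u1 - q * v1) ^+ 2 +
    (t2 - p * u2 - q * v2) ^+ 2 =
  (t0 ^+ 2 + t1 ^+ 2 + t2 ^+ 2) - 2 * p ^+ 2 - 2 * q ^+ 2 +
  p ^+ 2 * (u0 ^+ 2 + u1 ^+ 2 + u2 ^+ 2) + q ^+ 2 * (v0 ^+ 2 + v1 ^+ 2 + v2 ^+ 2) +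
  2 * p * q * (u0 * v0 + u1 * v1 + u2 * v2) by rewrite /p /q; ring.
rewrite t1E u1E uv.
have : q ^+ 2 * (v0 ^+ 2 + v1 ^+ 2 + v2 ^+ 2) <= q ^+ 2 by rewrite ler_piMr // sqr_ge0.
lra.
Qed.

(* With s the vector of square roots of l(z), s = x + i y, the extremal a is
   x/|x| - i y/|y|, for which a.s = |x| + |y|. If y = 0 then y/|y| = 0. *)
Lemma siciak_ge_simplex d (E : set 'rV[C]_d) (l0 l1 l2 : 'rV[C]_d -> C) c z :
  polynomial_fun l0 -> polynomial_fun l1 -> polynomial_fun l2 -> 0 < c ->
  (forall w, [/\ normc (l0 w) <= c * (1 + enorm w), normc (l1 w) <= c * (1 + enorm w) &
    normc (l2 w) <= c * (1 + enorm w)]) ->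
  (forall w, E w -> exists t0 t1 t2 : R, [/\ l0 w = (t0 ^+ 2)%:C, l1 w = (t1 ^+ 2)%:C,
    l2 w = (t2 ^+ 2)%:C & t0 ^+ 2 + t1 ^+ 2 + t2 ^+ 2 = 1]) ->
  l0 z + l1 z + l2 z = 1 ->
  ((2 * ln (1 + Num.sqrt ((normc (l0 z) + normc (l1 z) + normc (l2 z) - 1) / 2)))%:E
    <= siciak E z)%E.
Proof.
move=> P0 P1 P2 c0 lgrowth lE sum1.
have [e0 e1 e2] := And3 (sqr_sqrtc (l0 z)) (sqr_sqrtc (l1 z)) (sqr_sqrtc (l2 z)).
move: (sqrtc (l0 z)) (sqrtc (l1 z)) (sqrtc (l2 z)) e0 e1 e2 => [x0 y0] [x1 y1] [x2 y2] e0 e1 e2.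
(* The squares of the components of s = x + i y add up to 1: the real part says |x|^2 = 1 + |y|^2,
   the imaginary part that x and y are orthogonal. *)
have [re im] : x0 * x0 - y0 * y0 + (x1 * x1 - y1 * y1) + (x2 * x2 - y2 * y2) = 1 /\
    x0 * y0 + y0 * x0 + (x1 * y1 + y1 * x1) + (x2 * y2 + y2 * x2) = 0.
  by move: sum1; rewrite -e0 -e1 -e2 => /eqP; rewrite eq_complex /= => /andP[/eqP ? /eqP ?].
have nE : normc (l0 z) + normc (l1 z) + normc (l2 z) =
    (x0 ^+ 2 + x1 ^+ 2 + x2 ^+ 2) + (y0 ^+ 2 + y1 ^+ 2 + y2 ^+ 2).
  by rewrite -e0 -e1 -e2 !normcX !sqr_normc /=; ring.
set Y2 := y0 ^+ 2 + y1 ^+ 2 + y2 ^+ 2 in nE.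
set X2 := x0 ^+ 2 + x1 ^+ 2 + x2 ^+ 2 in nE.
have Y20 : 0 <= Y2 by rewrite !addr_ge0 // sqr_ge0.
have X2E : X2 = 1 + Y2 by rewrite /X2 /Y2; lra.
(* Here h = |x|^2 + |y|^2 = 1 + 2 |y|^2, and h + sqrt (h^2 - 1) = (|x| + |y|)^2. Replacing |x| by
   its lower bound 1 gives the stated 2 ln (1 + |y|), with the same first order as y tends to 0. *)
rewrite nE X2E (_ : (1 + Y2 + Y2 - 1) / 2 = Y2); last by field.
set Y := Num.sqrt Y2; have Y0 : 0 <= Y := sqrtr_ge0 _.
have Y2E : Y2 = Y ^+ 2 by rewrite sqr_sqrtr.
pose X := Num.sqrt X2.
have X20 : 0 <= X2 by rewrite X2E addr_ge0.
have X1 : 1 <= X by rewrite -sqrtr1 ler_sqrt // X2E lerDl.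
have X0 : 0 < X := lt_le_trans ltr01 X1.
have X2X : X2 = X ^+ 2 by rewrite sqr_sqrtr.
have xy : x0 * y0 + x1 * y1 + x2 * y2 = 0 by lra.
pose a (x y : R) : R[i] := (x / X) +i* (- (y / Y)).
have unit_a (t0 t1 t2 : R) : t0 ^+ 2 + t1 ^+ 2 + t2 ^+ 2 = 1 ->
    normc (a x0 y0 * t0%:C + a x1 y1 * t1%:C + a x2 y2 * t2%:C) <= 1.
  move=> t1E; rewrite -(@expr_le1 _ 2) ?normc_ge0 // sqr_normc /=.
  have u1 : (x0 / X) ^+ 2 + (x1 / X) ^+ 2 + (x2 / X) ^+ 2 = 1.
    by rewrite !expr_div_n -!mulrDl -/X2 X2X divff // expf_neq0 // gt_eqF.
  have v1 : (y0 / Y) ^+ 2 + (y1 / Y) ^+ 2 + (y2 / Y) ^+ 2 <= 1.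
    rewrite !expr_div_n -!mulrDl -/Y2 Y2E.
    by have [->|Yn0] := eqVneq Y 0; rewrite ?expr0n ?mul0r // divff // expf_neq0.
  have uv : x0 / X * (y0 / Y) + x1 / X * (y1 / Y) + x2 / X * (y2 / Y) = 0.
    by transitivity ((x0 * y0 + x1 * y1 + x2 * y2) * (X^-1 * Y^-1)); [ring|rewrite xy mul0r].
  have := bessel3 u1 v1 uv t1E; apply: le_trans.
  by rewrite le_eqVlt; apply/orP; left; apply/eqP; ring.
have sgE : a x0 y0 * (x0 +i* y0) + a x1 y1 * (x1 +i* y1) + a x2 y2 * (x2 +i* y2) = (X + Y)%:C.
  have XX : X = X2 / X by rewrite X2X expr2 mulfK // gt_eqF.
  have YY : Y = Y2 / Y.
    by rewrite Y2E expr2; have [->|Yn0] := eqVneq Y 0; rewrite ?mul0r // mulfK.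
  apply: complex_eq; rewrite /=; first by transitivity (X2 / X + Y2 / Y);
    [rewrite /X2 /Y2; ring|rewrite -XX -YY].
  transitivity ((x0 * y0 + x1 * y1 + x2 * y2) * (X^-1 - Y^-1)); first by ring.
  by rewrite xy mul0r.
have nsg : normc ((X + Y)%:C : R[i]) = X + Y.
  by rewrite /= expr0n addr0 sqrtr_sqr ger0_norm // addr_ge0 // ltW.
have := siciak_ge_roots P0 P1 P2 c0 lgrowth lE unit_a e0 e1 e2.
rewrite sgE nsg lnXn; last by rewrite ltr_wpDr.
move=> /(_ (ltr_wpDr Y0 X0)); apply: le_trans.
have Y1 : 0 < 1 + Y by rewrite ltr_wpDr.
rewrite lee_fin -[leRHS]mulr_natl.
by rewrite ler_wpM2l // ler_ln ?posrE ?ltr_wpDr // lerD2r.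
Qed.

End SimplexLowerBoundExplicit.

(** * Upper bounds for the extremal function *)

Section UpperSemicontinuity.
Context {R : realType} {X : topologicalType}.
Implicit Types (Q : set X) (f : X -> \bar R) (phi : X -> R).

Definition usc_at f x := forall m : R, (f x < m%:E)%E -> \forall y \near x, (f y < m%:E)%E.

Lemma usc_atB f phi x : usc_at f x -> {for x, continuous phi} ->
  usc_at (fun y => f y - (phi y)%:E)%E x.
Proof.
move=> uf cphi m; rewrite lteBlDr // -EFinD.
case fx : (f x) => [r| |] //; last first.
  move=> _; near=> y; rewrite lteBlDr // -EFinD.
  apply: (@lt_trans _ _ (m + (phi x - 1))%:E).
    by near: y; apply: uf; rewrite fx ltNyr.
  rewrite lte_fin ltrD2l; near: y; apply: (cvgr_gt _ cphi).
  by rewrite ltrBlDr ltrDl.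
rewrite lte_fin => rm; pose e := (m + phi x - r) / 2.
have e0 : 0 < e by rewrite divr_gt0 // subr_gt0.
near=> y; rewrite lteBlDr // -EFinD.
apply: (@lt_trans _ _ (r + e)%:E).
  by near: y; apply: uf; rewrite fx lte_fin ltrDl.
rewrite lte_fin; suff : phi x - e < phi y by rewrite /e; lra.
by near: y; apply: (cvgr_gt _ cphi); rewrite ltrBlDr ltrDl.
Unshelve. all: end_near. Qed.

(** The sets {y in Q | f x0 <= f y} generate a filter. Without a maximum, every x has a
    neighbourhood on which f stays below f i for all i far enough in the filter; compactness makes
    this uniform in x, and x = i gives f i < f i. *)
Lemma usc_compact_max Q f : compact Q -> Q !=set0 ->
  (forall x, Q x -> usc_at f x) ->
  exists2 x0, Q x0 & forall x, Q x -> (f x <= f x0)%E.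
Proof.
move=> cQ [q Qq] uf; apply: contrapT => nomax.
have up x : Q x -> exists2 y, Q y & (f x < f y)%E.
  move=> Qx; apply: contrapT => nup; apply: nomax; exists x => // y Qy.
  by rewrite leNgt; apply/negP => xy; apply: nup; exists y.
pose F := filter_from Q (fun x0 => [set y | Q y /\ (f x0 <= f y)%E]).
have FF : Filter F.
  apply: filter_from_filter; first by exists q.
  move=> i j Qi Qj; have [ij|/ltW ji] := leP (f i) (f j).
    by exists j => // y [Qy jy]; split; split => //; exact: le_trans jy.
  by exists i => // y [Qy jy]; split; split => //; exact: le_trans jy.
have := (compact_near_coveringP Q).1 cQ X F (fun i x => (f x < f i)%E) FF.
case=> [x Qx|y Qy cov].
  have [y Qy xy] := up _ Qx.
  have [m xm my] : exists2 m : R, (f x < m%:E)%E & (m%:E <= f y)%E.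
    move: xy; case: (f x) => [a| |]; case: (f y) => [b| |] //.
    - rewrite lte_fin => ab; exists b => //; by rewrite lte_fin.
    - by move=> _; exists (a + 1); rewrite ?leey // lte_fin ltrDl.
    - by move=> _; exists b; rewrite ?ltNyr.
    - by move=> _; exists 0; rewrite ?ltNyr ?leey.
  exists ([set z | (f z < m%:E)%E], [set z | Q z /\ (f y <= f z)%E]) => /=.
    by split; [exact: uf|exists y].
  by move=> [z i] /= [zm [_ yi]]; exact: lt_le_trans zm (le_trans my yi).
by have := cov y (conj Qy (lexx _)) y Qy; rewrite ltxx.
Qed.

(** Near a zero of phi the bound delta holds with any K >= 0. Near any other point f is bounded
    above and phi is bounded away from 0, so a large K works. Compactness makes K uniform. *)
Lemma usc_penalty Q f phi (delta : R) : compact Q ->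
  (forall x, Q x -> usc_at f x) -> (forall x, Q x -> (f x < +oo)%E) ->
  continuous phi -> (forall x, 0 <= phi x) ->
  (forall x, Q x -> phi x = 0 -> (f x < delta%:E)%E) ->
  exists K0 : R, forall K, K0 <= K -> forall x, Q x -> (f x <= (delta + K * phi x)%:E)%E.
Proof.
move=> cQ uf finf cphi phi0 fd.
have [|K0 [_ HK]] := (compact_near_coveringP Q).1 cQ R (pinfty_nbhs R)
    (fun K x => (f x <= (delta + K * phi x)%:E)%E) _; last first.
  exists (K0 + 1) => K KK x Qx; apply: HK => //.
  by rewrite (lt_le_trans _ KK) // ltrDl.
move=> x Qx; have [p0|pn0] := eqVneq (phi x) 0.
  exists ([set z | (f z < delta%:E)%E], [set K | 0 <= K]) => /=.
    by split; [exact: uf (fd _ Qx p0)|exact: nbhs_pinfty_ge].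
  move=> [z K] /= [zd K0]; rewrite (le_trans (ltW zd)) // lee_fin lerDl.
  by rewrite mulr_ge0.
have p0 : 0 < phi x by rewrite lt0r pn0 phi0.
have [M fM] : exists M : R, (f x < M%:E)%E.
  case: (f x) (finf x Qx) => [a _| |_]; first by exists (a + 1); rewrite lte_fin ltrDl.
    by rewrite ltxx.
  by exists 0; rewrite ltNyr.
pose K1 := Num.max 0 ((M - delta) / (phi x / 2)).
exists ([set z | (f z < M%:E)%E /\ phi x / 2 < phi z], [set K | K1 <= K]) => /=.
  split; last by apply: nbhs_pinfty_ge; exact: num_real.
  apply: filterI; first exact: uf.
  by apply: (cvgr_gt _ (cphi x)); rewrite ltr_pdivrMr // ltr_pMr // ltr1n.
move=> [z K] /= [[zM pz] KK]; rewrite (le_trans (ltW zM)) // lee_fin.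
move: KK; rewrite ge_max => /andP[K0]; rewrite ler_pdivrMr ?divr_gt0 // => h.
have : K * (phi x / 2) <= K * phi z by rewrite ler_wpM2l // ltW.
lra.
Qed.

End UpperSemicontinuity.

(** * Sub-mean value inequality at a point of contact *)

Section SubmeanContact.
Context {R : realType}.
Local Notation C := (R[i]^o).
Local Notation normc := Normc.normc.
Local Open Scope complex_scope.

(* Unlike [le_integral], no measurability is required. *)
Lemma integral_monotone d (T : measurableType d) (mu : {measure set T -> \bar R})
    (D : set T) (f g : T -> \bar R) : (forall x, D x -> (f x <= g x)%E) ->
  (\int[mu]_(x in D) f x <= \int[mu]_(x in D) g x)%E.
Proof.
move=> fg; have fgD x : ((f \_ D) x <= (g \_ D) x)%E.
  by rewrite !patchE; case: ifPn => // /set_mem /fg.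
rewrite /integral; apply: leeB; apply: ereal_sup_le => _ [h hf <-]; exists h => // x.
  by apply: (le_trans (hf x));
    apply: (@funepos_le _ _ setT) => [y _|]; [exact: fgD|exact: in_setT].
by apply: (le_trans (hf x));
  apply: (@funeneg_le _ _ setT) => [y _|]; [exact: fgD|exact: in_setT].
Qed.

Lemma normc_circle r t : 0 <= r -> normc (r%:C * (cos t +i* sin t) : R[i]) = r.
Proof.
move=> r0; rewrite Normc.normcM /= expr0n addr0 sqrtr_sqr ger0_norm //.
by rewrite cos2Dsin2 sqrtr1 mulr1.
Qed.

(** A majorant h touching w at 0 cannot have circle means below h(0) at arbitrarily small radii,
    since those of w are at least w(0) = h(0). *)
Lemma submean_contact (w : C -> \bar R) (h : C -> R) (delta : R) :
  subharmonic w -> w 0 = (h 0)%:E -> 0 < delta ->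
  (forall l, normc l < delta -> (w l <= (h l)%:E)%E) ->
  (forall e, 0 < e -> exists r m, [/\ 0 <= r < e,
     circle_mean (fun t => h (r%:C * (cos t +i* sin t))) m & m < h 0]) -> False.
Proof.
move=> [_ _ /(_ 0)[rho rho0 sub]] w0 d0 wh mean.
have [|r [m [/andP[r0]]]] := mean (Num.min rho delta); first by rewrite lt_min rho0.
rewrite lt_min => /andP[rrho rd] /circle_meanE E mh.
have := sub r; rewrite r0 rrho => /(_ isT); rewrite w0.
apply/negP; rewrite -ltNge (@le_lt_trans _ _ m%:E) ?lte_fin // -E.
apply: lee_wpmul2l; first by rewrite lee_fin invr_ge0 mulr_ge0 ?pi_ge0.
apply: integral_monotone => t _.
by rewrite add0r; apply: wh; rewrite normc_circle.
Qed.

End SubmeanContact.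

(** * A barrier near the hyperbola A B = 1 *)

Section Hyperbola.
Context {R : realType}.
Local Notation C := (R[i]^o).
Local Notation normc := Normc.normc.
Local Open Scope complex_scope.

Lemma ln_normc_mul1D_circle_mean (A : R[i]) r : A != 0 -> 0 <= r < 1 ->
  circle_mean (fun t => ln (normc (A * (1 + r%:C * (cos t +i* sin t))))) (ln (normc A)).
Proof.
move=> A0 /andP[r0 r1].
have r01 : 0 <= r < normc (1 : R[i]) by rewrite Normc.normc1 r0.
have := circle_meanD (circle_mean_cst (ln (normc A))) (ln_normc_circle_mean r01).
rewrite Normc.normc1 ln1 addr0; apply: circle_mean_eq => t.
rewrite Normc.normcM lnM ?posrE ?normc_gt0 //.
apply/eqP => /eqP; rewrite addr_eq0 => /eqP E.
have := @normc_circle R r t r0.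
rewrite -[_ * _]opprK -E normc_opp Normc.normc1 => r1'.
by move: r1; rewrite r1' ltxx.
Qed.

Lemma sqr_normc_mul1D_circle_mean (A : R[i]) r :
  circle_mean (fun t => normc (A * (1 + r%:C * (cos t +i* sin t))) ^+ 2)
    (normc A ^+ 2 * (1 + r ^+ 2)).
Proof.
have := circle_meanD (circle_mean_cst (normc A ^+ 2 * (1 + r ^+ 2)))
  (circle_meanZ (normc A ^+ 2 * 2 * r) (@cos_circle_mean R)).
rewrite mulr0 addr0; apply: circle_mean_eq => t.
rewrite Normc.normcM exprMn [X in _ = _ * X]sqr_normc /=.
by have s2 := sin2cos2 t; ring: s2.
Qed.

(** The number inside is (c - 1) - c l^2; the cross term has frequency 2 and averages to 0, which
    leaves |c|^2 r^4. *)
Lemma sqr_normc_sub1_circle_mean (c : R[i]) r :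
  circle_mean (fun t => let l := r%:C * (cos t +i* sin t) in
                normc (c * (1 - l ^+ 2) - 1) ^+ 2)
    (normc (c - 1) ^+ 2 + normc c ^+ 2 * r ^+ 4).
Proof.
case: c => c1 c2.
have := circle_meanD (circle_mean_cst (normc ((c1 +i* c2) - 1) ^+ 2 +
    normc (c1 +i* c2) ^+ 2 * r ^+ 4))
  (circle_meanD
    (circle_meanZ (- 2 * r ^+ 2 * ((c1 - 1) * c1 + c2 * c2)) (@cos2_circle_mean R))
    (circle_meanZ (4 * r ^+ 2 * ((c1 - 1) * c2 - c2 * c1)) (@sin2_circle_mean R))).
rewrite !mulr0 !addr0; apply: circle_mean_eq => t.
rewrite /= !expr2 -!expr2 !sqr_sqrtr ?addr_ge0 ?sqr_ge0 //=.
by have s2 := sin2cos2 t; ring: s2.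
Qed.

Definition conic d (c a b : 'rV[C]_d) (A B : C) : 'rV[C]_d := c + A *: a + B *: b.

(** The slope 1 + s beats the logarithmic growth of u at large |A|, - eta |A|^2 makes the barrier
    strictly superharmonic along suitable lines, and the term in K confines the contact to the
    vicinity of A B = 1. *)
Definition penalty (s eta K : R) (A B : C) : R :=
  (1 + s) * ln (normc A) - eta * normc A ^+ 2 + K * normc (A * B - 1) ^+ 2.

(* Along the line l |-> (A0 (1 + l), B0 (1 - l)) the product A B is
   A0 B0 (1 - l^2), so that the circle mean of |A B - 1|^2 differs from its
   central value only at order r^4, while that of eta |A|^2 does at order r^2. *)
Lemma no_interior_contact d (u : 'rV[C]_d -> \bar R) (c a b : 'rV[C]_d) (A0 B0 : C)
    (rmax s eta K v0 : R) :
  plurisubharmonic u -> 0 < eta -> 0 <= K -> 1 < normc A0 < rmax -> normc B0 < 2 ->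
  u (conic c a b A0 B0) = v0%:E ->
  (forall A B, 1 <= normc A <= rmax -> normc B <= 2 ->
    (u (conic c a b A B) <= (v0 - penalty s eta K A0 B0 + penalty s eta K A B)%:E)%E) ->
  False.
Proof.
move=> [_ _ psh] eta0 K0 /andP[A1 Ar] B2 uv0 le.
set nA := normc A0 in A1 Ar; set nB := normc B0 in B2.
have nA0 : 0 < nA := lt_trans ltr01 A1.
have nB0 : 0 <= nB := normc_ge0 _.
have A0n : A0 != 0 by rewrite -normc_gt0.
pose w (l : C) := u (conic c a b A0 B0 + l *: (A0 *: a - B0 *: b)).
have wE l : w l = u (conic c a b (A0 * (1 + l)) (B0 * (1 - l))).
  by rewrite /w; congr u; apply/rowP => k; rewrite /conic !mxE; ring.
pose h (l : C) := v0 - penalty s eta K A0 B0 +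
  penalty s eta K (A0 * (1 + l)) (B0 * (1 - l)).
(* Such l keep (A0 (1 + l), B0 (1 - l)) in the region where the majorant is assumed. The denominator
   is |B0| + 1 because B0 may be 0. *)
pose dl := Num.min ((nA - 1) / nA) (Num.min ((rmax - nA) / nA) ((2 - nB) / (nB + 1))).
have nB1 : 0 < nB + 1 by rewrite ltr_wpDl.
have dl0 : 0 < dl by rewrite !lt_min !divr_gt0 // subr_gt0.
have [dl1 dl2 dl3] : [/\ nA * dl <= nA - 1, nA * dl <= rmax - nA & nB * dl <= 2 - nB].
  have [h1 h2 h3] : [/\ dl <= (nA - 1) / nA, dl <= (rmax - nA) / nA & dl <= (2 - nB) / (nB + 1)].
    by rewrite /dl !ge_min !lexx !orbT.
  split; [by rewrite mulrC -ler_pdivlMr|by rewrite mulrC -ler_pdivlMr|].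
  move: h3; rewrite ler_pdivlMr // => h3; apply: le_trans h3; rewrite mulrC.
  by rewrite ler_pM2l // lerDl.
apply: (@submean_contact R w h dl (psh _ _)) => //.
- rewrite wE /h addr0 subr0 !mulr1 uv0; congr EFin; ring.
- move=> l ldl; rewrite wE; apply: le.
    have n1 : normc (A0 * (1 + l)) <= nA + nA * normc l.
      by rewrite mulrDr mulr1 (le_trans (ler_normc_add _ _)) // Normc.normcM.
    have n2 : nA <= normc (A0 * (1 + l)) + nA * normc l.
      rewrite /nA -Normc.normcM -[X in _ <= _ + X]normc_opp.
      by apply: le_trans (ler_normc_add _ _); rewrite mulrDr mulr1 addrK.
    have n3 : nA * normc l <= nA * dl by rewrite ler_pM2l // ltW.
    by apply/andP; split; lra.
  have n1 : normc (B0 * (1 - l)) <= nB + nB * normc l.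
    by rewrite mulrBr mulr1 (le_trans (ler_normc_add _ _)) // normc_opp Normc.normcM.
  have n3 : nB * normc l <= nB * dl by rewrite ler_wpM2l // ltW.
  lra.
move=> e e0.
(* For 0 < r^2 < q the increase K |A0 B0|^2 r^4 of the mean is smaller than the decrease eta |A0|^2
   r^2. *)
pose q := eta / (K * nB ^+ 2 + 1).
have KB : 0 < K * nB ^+ 2 + 1 by rewrite ltr_wpDl // mulr_ge0 // sqr_ge0.
have q0 : 0 < q by rewrite divr_gt0.
pose r := Num.min (e / 2) (Num.min (1 / 2) (q / 2)).
have r0 : 0 < r by rewrite !lt_min !divr_gt0.
have [re r1 rq] : [/\ r <= e / 2, r <= 1 / 2 & r <= q / 2].
  by rewrite /r !ge_min !lexx !orbT.
exists r.
have r01 : 0 <= r < 1 by rewrite ltW //=; lra.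
have M1 := ln_normc_mul1D_circle_mean A0n r01.
have M2 := sqr_normc_mul1D_circle_mean A0 r.
have M3 := sqr_normc_sub1_circle_mean (A0 * B0) r.
have M := circle_meanD (circle_mean_cst (v0 - penalty s eta K A0 B0))
  (circle_meanD (circle_meanD (circle_meanZ (1 + s) M1) (circle_meanZ (- eta) M2))
     (circle_meanZ K M3)).
eexists; split; last first.
- rewrite /h addr0 subr0 !mulr1 /penalty -/nA.
  instantiate (1 := v0 - penalty s eta K A0 B0 + ((1 + s) * ln nA -
    eta * (nA ^+ 2 * (1 + r ^+ 2)) +
    K * (normc (A0 * B0 - 1) ^+ 2 + (nA * nB) ^+ 2 * r ^+ 4))).
  rewrite /penalty -/nA.
  have : K * (nA * nB) ^+ 2 * r ^+ 4 < eta * nA ^+ 2 * r ^+ 2; last by lra.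
  have -> : K * (nA * nB) ^+ 2 * r ^+ 4 = (nA ^+ 2 * r ^+ 2) * (K * nB ^+ 2 * r ^+ 2) by ring.
  have -> : eta * nA ^+ 2 * r ^+ 2 = (nA ^+ 2 * r ^+ 2) * eta by ring.
  rewrite ltr_pM2l; last by rewrite mulr_gt0 // exprn_gt0.
  have qE : q * (K * nB ^+ 2 + 1) = eta by rewrite divfK // gt_eqF.
  have rr : r ^+ 2 < q by rewrite expr2; nra.
  apply: (@le_lt_trans _ _ ((K * nB ^+ 2 + 1) * r ^+ 2)).
    by rewrite ler_wpM2r ?sqr_ge0 // lerDl.
  by rewrite -qE mulrC ltr_pM2r.
- move: M; rewrite Normc.normcM -/nA -/nB mulNr; apply: circle_mean_eq => t.
  rewrite /h /penalty; congr (_ + (_ + _ * _ ^+ 2)); first by rewrite mulNr.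
  by congr normc; ring.
- by apply/andP; split; lra.
Qed.

Lemma enorm_le_sum d (z : 'rV[C]_d) : enorm z <= \sum_k normc (z 0 k).
Proof.
rewrite /enorm -[leRHS]ger0_norm; last by apply: sumr_ge0 => k _; exact: normc_ge0.
rewrite -sqrtr_sqr ler_sqrt ?sqr_ge0 //.
suff [] : \sum_k normc (z 0 k) ^+ 2 <= (\sum_k normc (z 0 k)) ^+ 2 /\
  0 <= \sum_k normc (z 0 k) by [].
elim/big_rec2 : _ => [|k y1 y2 _ [le y0]]; first by rewrite expr0n.
have k0 := normc_ge0 (z 0 k); split; last exact: addr_ge0.
by rewrite sqrrD; nra.
Qed.

(** As |A| >= 1 and |B| <= 2, the quantity 1 + |c + A a + B b| is at most |A| times a constant
    [S]. *)
Lemma lelong_conic_growth d (u : 'rV[C]_d -> \bar R) (c a b : 'rV[C]_d) : lelong u ->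
  exists L : R, forall A B, 1 <= normc A -> normc B <= 2 ->
    (u (conic c a b A B) <= (ln (normc A) + L)%:E)%E.
Proof.
move=> [_ [M uM]].
pose S := 1 + \sum_k (normc (c 0 k) + normc (a 0 k) + 2 * normc (b 0 k)).
have S0 : 0 < S.
  rewrite ltr_pwDl // sumr_ge0 // => k _.
  by rewrite !addr_ge0 ?mulr_ge0 ?normc_ge0.
exists (ln S + M) => A B A1 B2; rewrite (le_trans (uM _)) // lee_fin addrA lerD2r.
have A0 : 0 < normc A := lt_le_trans ltr01 A1.
rewrite -lnM ?posrE // ler_ln ?posrE ?mulr_gt0 //; last by rewrite ltr_pwDl ?enorm_ge0.
rewrite /S mulrDr mulr1 lerD // (le_trans (enorm_le_sum _)) // mulr_sumr.
apply: ler_sum => k _; rewrite !mxE !mulrDr.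
rewrite (le_trans (ler_normc_add _ _)) // lerD //; last first.
  rewrite Normc.normcM mulrA ler_wpM2r ?normc_ge0 //.
  by rewrite (le_trans B2) // ler_peMl.
rewrite (le_trans (ler_normc_add _ _)) // lerD //; last by rewrite Normc.normcM.
by rewrite ler_peMl // normc_ge0.
Qed.

Lemma continuous_real_complex : continuous (fun x : R => x%:C : C).
Proof.
move=> x A /nearC[e e0 eA]; apply/nbhs_ballP; exists e => //= y.
rewrite /ball /= => xy; apply: eA.
have -> : x%:C - y%:C = (x - y)%:C :> R[i] by rewrite rmorphB.
by rewrite /= expr0n addr0 sqrtr_sqr.
Qed.

Lemma compact_annulus (r1 r2 : R) : compact [set z : C | r1 <= normc z <= r2].
Proof.
have cl : closed [set z : C | r1 <= normc z <= r2].
  have -> : [set z : C | r1 <= normc z <= r2] = (@Normc.normc R : C -> R) @^-1` `[r1, r2].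
    by apply/seteqP; split=> z; rewrite /= in_itv.
  by apply: closed_comp => [z _|]; [exact: continuous_normc|exact: itv_closed].
pose f (p : R * R) : C := p.1%:C + 'i%C * p.2%:C.
have cf : continuous f.
  apply: continuous_addC.
    move=> p; apply: (@continuous_comp _ _ _ fst (fun x : R => x%:C : C)).
      exact: cvg_fst.
    exact: continuous_real_complex.
  apply: continuous_mulC; first exact: cst_continuous.
  move=> p; apply: (@continuous_comp _ _ _ snd (fun x : R => x%:C : C)).
    exact: cvg_snd.
  exact: continuous_real_complex.
apply: (@subclosed_compact _ _ (f @` (`[- r2, r2] `*` `[- r2, r2]))) => //.
  apply: continuous_compact; first exact: continuous_subspaceT.
  by apply: compact_setX; exact: segment_compact.
move=> z /= /andP[_ zr]; exists (complex.Re z, complex.Im z); last first.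
  by rewrite /f /= -complexE.
have b (x : R) : x ^+ 2 <= normc z ^+ 2 -> x \in `[- r2, r2].
  move=> h; rewrite in_itv /= -ler_norml (le_trans _ zr) //.
  by rewrite -ler_sqr ?nnegrE ?normc_ge0 // real_normK ?num_real.
by split; apply: b; rewrite sqr_normc ?lerDl ?lerDr sqr_ge0.
Qed.

Lemma continuous_conic d (c a b : 'rV[C]_d) :
  continuous (fun p : C * C => conic c a b p.1 p.2).
Proof.
apply: continuous_to_mx => i j; rewrite /conic.
under eq_fun do rewrite !mxE.
apply: continuous_addC; [apply: continuous_addC|]; first exact: cst_continuous;
  apply: continuous_mulC; try exact: cst_continuous.
- by move=> p; exact: cvg_fst.
- by move=> p; exact: cvg_snd.
Qed.

Lemma continuous_sqr_normc_sub1 : continuous (fun p : C * C => normc (p.1 * p.2 - 1) ^+ 2).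
Proof.
have cf : continuous (fun p : C * C => p.1 * p.2 - 1 : C).
  apply: continuous_addC; last exact: cst_continuous.
  by apply: continuous_mulC => p; [exact: cvg_fst|exact: cvg_snd].
have cn : continuous (fun p : C * C => normc (p.1 * p.2 - 1)).
  by move=> p; apply: (continuous_comp (cf p)); exact: continuous_normc.
by move=> p; exact: (cvgM (cn p) (cn p)).
Qed.

Lemma continuous_penalty s eta K (p : C * C) : p.1 != 0 ->
  {for p, continuous (fun q => penalty s eta K q.1 q.2)}.
Proof.
move=> p0.
have cn : {for p, continuous (fun q : C * C => normc q.1)}.
  apply: (@continuous_comp _ _ _ fst (@Normc.normc R : C -> R)).
    exact: cvg_fst.
  exact: continuous_normc.
rewrite /penalty; apply: cvgD; last first.
  by apply: cvgM; [exact: cvg_cst|exact: continuous_sqr_normc_sub1].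
apply: cvgB; apply: cvgM; try exact: cvg_cst.
  apply: (continuous_comp cn); apply: continuous_ln.
  by rewrite normc_gt0.
exact: (cvgM cn cn).
Qed.

End Hyperbola.

Section HyperbolaBound.
Context {R : realType}.
Local Notation C := (R[i]^o).
Local Notation normc := Normc.normc.
Local Open Scope complex_scope.

(** If the bound failed by 2 g, u minus the penalty would have a maximum greater than g on 1 <= |A|
    <= rmax, |B| <= 2. The parameters exclude each part of the boundary, and an interior maximum
    contradicts [no_interior_contact]. *)
Lemma hyperbola_bound d (u : 'rV[C]_d -> \bar R) (c a b : 'rV[C]_d) (zeta : R) :
  lelong u -> (forall A : C, normc A = 1 -> (u (conic c a b A A^-1)%R <= 0)%E) ->
  1 < zeta -> (u (conic c a b zeta%:C (zeta^-1)%:C)%R <= (ln zeta)%:E)%E.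
Proof.
move=> lu u0 z1; have [L growth] := lelong_conic_growth c a b lu.
have [psh _] := lu; have [fin /usc_nearP usc _] := psh.
rewrite leNgt; apply/negP; set Z := conic _ _ _ _ _.
have := fin Z; case uZ : (u Z) => [uz| |] // _; rewrite lte_fin => uzln.
have z0 : 0 < zeta := lt_trans ltr01 z1.
have lz0 : 0 < ln zeta by rewrite ln_gt0.
pose g := (uz - ln zeta) / 2; have g0 : 0 < g by rewrite divr_gt0 // subr_gt0.
(* As s ln zeta = g, the steeper slope 1 + s uses up only half of the excess 2 g. *)
pose s := g / ln zeta; have s0 : 0 < s by rewrite divr_gt0.
(* At |A| = rmax the gain s ln |A| is at least |L|, which beats the growth bound. *)
pose rmax := Num.max (zeta + 1) (expR (`|L| / s)).
have [rz rL] : zeta + 1 <= rmax /\ expR (`|L| / s) <= rmax by rewrite /rmax !le_max !lexx orbT.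
have r1 : 1 < rmax by lra.
have rp : 0 < rmax by lra.
have lnr : `|L| <= s * ln rmax.
  rewrite mulrC -ler_pdivrMr // -[leLHS]expRK ler_ln ?posrE ?expR_gt0 //.
(* On the whole region eta |A|^2 is at most g / 4. *)
pose eta := g / 4 / rmax ^+ 2.
have rr : 1 <= rmax ^+ 2 by apply: exprn_ege1; exact: ltW.
have etar : eta * rmax ^+ 2 = g / 4 by rewrite divfK // expf_neq0 // gt_eqF.
have eta0 : 0 < eta by apply: divr_gt0; [exact: divr_gt0|exact: exprn_gt0].
pose v (p : C * C) := u (conic c a b p.1 p.2).
have uv p : usc_at v p.
  move=> m vm; exact: (@continuous_conic R d c a b p _ (usc _ _ vm)).
pose phi (p : C * C) := normc (p.1 * p.2 - 1) ^+ 2.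
have [K0 HK0] : exists K0 : R, forall K, K0 <= K ->
    forall p, ([set z : C | 1 <= normc z <= 1] `*` [set z : C | 0 <= normc z <= 2]) p ->
      (v p <= (g / 4 + K * phi p)%:E)%E.
  apply: usc_penalty.
  - by apply: compact_setX; exact: compact_annulus.
  - by move=> p _; exact: uv.
  - by move=> p _; exact: fin.
  - exact: continuous_sqr_normc_sub1.
  - by move=> p; exact: sqr_ge0.
  - move=> [A B] /= [/andP[A1 A1'] _] /eqP.
    rewrite /phi /= expf_eq0 /= => /eqP/Normc.eq0_normc/eqP; rewrite subr_eq0 => /eqP AB.
    have nA : normc A = 1 by apply/eqP; rewrite eq_le A1' A1.
    have An0 : A != 0 by rewrite -normc_gt0 nA.
    have -> : B = A^-1 by rewrite -[LHS](mulKf An0) AB mulr1.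
    by apply: (le_lt_trans (u0 A nA)); rewrite lte_fin divr_gt0.
(* [K0] excludes the side |A| = 1, where u <= 0 is known only for B = 1 / A. On |B| = 2 one has |A B
   - 1| >= 1, so K >= |L| excludes that side. *)
pose K := Num.max K0 `|L|.
have [KK0 KL] : K0 <= K /\ `|L| <= K by rewrite /K !le_max !lexx orbT.
have Kge0 : 0 <= K by rewrite (le_trans _ KL).
pose Q := [set z : C | 1 <= normc z <= rmax] `*` [set z : C | 0 <= normc z <= 2].
have cQ : compact Q by apply: compact_setX; exact: compact_annulus.
pose f (p : C * C) := (v p - (penalty s eta K p.1 p.2)%:E)%E.
have nz (x : R) : 0 < x -> normc (x%:C : R[i]) = x.
  by move=> x0; rewrite /= expr0n addr0 sqrtr_sqr gtr0_norm.
have zQ : Q (zeta%:C : C, (zeta^-1)%:C : C).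
  have zV : zeta^-1 < 1 by rewrite invf_lt1.
  have zV0 : 0 < zeta^-1 by rewrite invr_gt0.
  have zA : 1 <= normc (zeta%:C : R[i]) <= rmax by rewrite nz //; apply/andP; split; lra.
  have zB : 0 <= normc (zeta^-1%:C : R[i]) <= 2 by rewrite nz //; apply/andP; split; lra.
  by split; [exact: zA|exact: zB].
have [[A0 B0] [/= /andP[A1 Ar] /andP[_ B2]] max] := usc_compact_max cQ (ex_intro _ _ zQ)
  (fun p (Qp : Q p) => usc_atB (uv p) (@continuous_penalty R s eta K p
     (etrans (esym (normc_gt0 p.1)) (lt_le_trans ltr01 (proj1 (andP Qp.1)))))).
have An0 : A0 != 0 by rewrite -normc_gt0 (lt_le_trans ltr01).
have nA0 : 0 < normc A0 by rewrite normc_gt0.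
have lnA : 0 <= ln (normc A0) by rewrite ln_ge0.
have Fz := max _ zQ.
have {}Fz : ((g + penalty s eta K A0 B0)%:E < u (conic c a b A0 B0))%E.
  move: Fz; rewrite /f /v /= -/Z uZ !EFinN -EFinB leeBrDr //; apply: lt_le_trans.
  rewrite -EFinD lte_fin ltrD2r /penalty nz // -rmorphM divff ?gt_eqF //.
  rewrite subrr Normc.normc0 expr0n /= mulr0 addr0.
  have : 0 < eta * zeta ^+ 2 by rewrite mulr_gt0 // exprn_gt0.
  have : s * ln zeta = g by rewrite divfK // gt_eqF.
  have : uz = ln zeta + g + g by rewrite /g; field.
  lra.
move: Fz (fin (conic c a b A0 B0)); case uv0 : (u (conic c a b A0 B0)) => [v0| |] //.
rewrite lte_fin => gv _.
have etaA : eta * normc A0 ^+ 2 <= g / 4.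
  by rewrite -etar ler_pM2l // lerXn2r // nnegrE ?normc_ge0 // ltW.
have LL : L <= `|L| := ler_norm L.
have vL : v0 <= ln (normc A0) + L.
  by rewrite -lee_fin -uv0; exact: growth.
have KN : 0 <= K * normc (A0 * B0 - 1) ^+ 2 by rewrite mulr_ge0 // sqr_ge0.
have slnA : 0 <= s * ln (normc A0) by rewrite mulr_ge0 // ltW.
have A1' : 1 < normc A0.
  rewrite lt_neqAle A1 andbT; apply/eqP => A1E.
  have : (v (A0, B0) <= (g / 4 + K * phi (A0, B0))%:E)%E.
    apply: HK0 => //; split; first by rewrite /= -A1E lexx.
    by rewrite /= normc_ge0 B2.
  rewrite /v uv0 lee_fin => v4.
  move: gv etaA; rewrite /penalty -A1E ln1 expr1n !mulr1 mulr0.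
  rewrite /phi /= in v4 *; lra.
have Ar' : normc A0 < rmax.
  rewrite lt_neqAle Ar andbT; apply/eqP => ArE.
  by move: gv lnr; rewrite /penalty -ArE; lra.
have B2' : normc B0 < 2.
  rewrite lt_neqAle B2 andbT; apply/eqP => B2E.
  have AB : 1 <= normc (A0 * B0 - 1).
    have := ler_normc_add (A0 * B0 - 1) 1.
    by rewrite subrK Normc.normcM Normc.normc1 B2E; lra.
  have : K <= K * normc (A0 * B0 - 1) ^+ 2 by rewrite ler_peMr // exprn_ege1.
  by move: gv; rewrite /penalty; lra.
apply: (@no_interior_contact _ _ u c a b A0 B0 rmax s eta K v0) => //.
  by rewrite A1' Ar'.
move=> A B An Bn.
have QAB : Q (A, B) by split; rewrite // /= normc_ge0 Bn.
have := max _ QAB.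
by rewrite /f /v uv0 !EFinN -EFinB leeBlDr // -EFinD.
Qed.

End HyperbolaBound.

(** * From an inscribed ellipse to an upper bound *)

Section EllipseUpperBound.
Context {R : realType}.
Local Notation C := (R[i]^o).
Local Notation normc := Normc.normc.
Local Open Scope complex_scope.

(* The ellipse is shrunk by kappa = 1 / cosh (ln zeta), so that the real part of
   the point of its complexification with parameter zeta is again c + alpha. *)
Lemma siciak_le_ellipse d (E : set 'rV[R]_d) (c alpha : 'rV[R]_d) (j : 'I_d) (s e : R) :
  0 < e < s ->
  (forall C S : R, C ^+ 2 + S ^+ 2 <= 1 ->
     E (c + C *: alpha + (S * s) *: delta_mx 0 j)) ->
  (siciak (@of_real R d @` E) (of_real (c + alpha) + (0 +i* e : C) *: delta_mx 0 j)%R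
    <= (e / (s - e))%:E)%E.
Proof.
move=> /andP[e0 es] ellE; have s0 : 0 < s := lt_trans e0 es.
have se0 : 0 < s - e by rewrite subr_gt0.
(* This solves tanh (ln zeta) = e / s, so that the shrunken ellipse reaches imaginary part exactly
   e. *)
pose zeta := Num.sqrt ((s + e) / (s - e)).
have z2 : zeta ^+ 2 = (s + e) / (s - e) by rewrite sqr_sqrtr // divr_ge0 ?ltW // addr_gt0.
have z1 : 1 < zeta.
  rewrite -sqrtr1 /zeta ltr_sqrt; last by rewrite divr_gt0 // addr_gt0.
  by rewrite ltr_pdivlMr //; lra.
have z0 : 0 < zeta := lt_trans ltr01 z1.
have zn0 : zeta != 0 by rewrite gt_eqF.
pose kappa := 2 * zeta / (zeta ^+ 2 + 1).
have z21 : 0 < zeta ^+ 2 + 1 by rewrite addr_gt0 // exprn_gt0.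
have k0 : 0 <= kappa by rewrite divr_ge0 ?ltW // mulr_gt0.
have k1 : kappa <= 1.
  rewrite ler_pdivrMr // mul1r -subr_ge0.
  by have := sqr_ge0 (zeta - 1); rewrite sqrrB1 mulr_natl addrAC.
pose a : 'rV[C]_d :=
  \row_k ((kappa / 2 * alpha 0 k) +i* (kappa / 2 * s * (delta_mx 0 j : 'rV[R]_d) 0 k)).
pose b : 'rV[C]_d :=
  \row_k ((kappa / 2 * alpha 0 k) +i* (- (kappa / 2 * s * (delta_mx 0 j : 'rV[R]_d) 0 k))).
have -> : of_real (c + alpha) + (0 +i* e : C) *: delta_mx 0 j =
    conic (of_real c) a b zeta%:C (zeta^-1)%:C.
  apply/rowP => k; rewrite !mxE.
  have kz : kappa / 2 * (zeta + zeta^-1) = 1.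
    by rewrite /kappa; field; rewrite zn0 gt_eqF.
  have kz' : kappa / 2 * (zeta - zeta^-1) * s = e.
    have -> : kappa / 2 * (zeta - zeta^-1) * s = (zeta ^+ 2 - 1) / (zeta ^+ 2 + 1) * s.
      by rewrite /kappa; field; rewrite zn0 gt_eqF.
    by rewrite z2; field; rewrite !gt_eqF //; lra.
  have -> : (0 == 0 :> 'I_1) && (k == j) = (k == j) by [].
  have -> : (k == j)%:R = ((k == j)%:R : R)%:C :> R[i] by case: (k == j).
  move: ((k == j)%:R : R) => D; apply: complex_eq => /=.
    transitivity (c 0 k + kappa / 2 * (zeta + zeta^-1) * alpha 0 k); last by ring.
    by rewrite kz; ring.
  transitivity (kappa / 2 * (zeta - zeta^-1) * s * D); last by ring.
  by rewrite kz'; ring.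
apply: ge_ereal_sup => _ [u [lu uE] <-].
apply: (@le_trans _ _ (ln zeta)%:E).
  apply: hyperbola_bound => // A An; apply: uE.
  have An0 : A != 0 by rewrite -normc_gt0 An.
  case: A An An0 => x y An An0.
  have xy : x ^+ 2 + y ^+ 2 = 1.
    by move: (sqr_normc (x +i* y)); rewrite An expr1n /=.
  have AV : (x +i* y)^-1 = x -i* y.
    apply: (mulfI An0); rewrite divff //; apply: complex_eq => /=; first by rewrite -xy; ring.
    by ring.
  exists (c + (kappa * x) *: alpha + ((- (kappa * y)) * s) *: delta_mx 0 j).
    apply: ellE; have -> : (kappa * x) ^+ 2 + (- (kappa * y)) ^+ 2 = kappa ^+ 2.
      by rewrite -[RHS]mulr1 -xy; ring.
    exact: exprn_ile1.
  rewrite AV; apply/rowP => k; rewrite !mxE.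
  by apply: complex_eq => /=; field.
rewrite lee_fin.
have l2 : ln (zeta ^+ 2) <= zeta ^+ 2 - 1.
  have := @le_ln1Dx R (zeta ^+ 2 - 1); rewrite [1 + _]addrC subrK; apply.
  by rewrite ltrBrDl subrr exprn_gt0.
have -> : e / (s - e) = (zeta ^+ 2 - 1) / 2 by rewrite z2; field; rewrite gt_eqF.
by rewrite ler_pdivlMr // mulr_natr -lnXn.
Qed.

End EllipseUpperBound.

(** * The trapezoid *)

Section DiniSqueeze.
Context {R : realType}.
Local Notation C := (R[i]^o).
Local Open Scope complex_scope.

Lemma limf_einf_squeeze (T : ptopologicalType) (F : set_system T) (f : T -> \bar R) (D : R) :
  ProperFilter F ->
  (forall e : R, 0 < e -> \forall x \near F, ((D - e)%:E <= f x <= (D + e)%:E)%E) ->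
  limf_einf f F = D%:E.
Proof.
move=> FF sq; rewrite limf_einfE; apply/eqP; rewrite eq_le; apply/andP; split.
  apply: ge_ereal_sup => _ [V FV <-]; apply/lee_addgt0Pr => e e0.
  have [x [Vx /andP[_ xD]]] := filter_ex (filterI FV (sq e e0)).
  by apply: le_trans xD; apply: ereal_inf_lbound; exists x.
apply/lee_addgt0Pr => e e0; rewrite -leeBlDr // -EFinB.
apply: le_ereal_sup_tmp.
exists (ereal_inf (f @` [set x | ((D - e)%:E <= f x <= (D + e)%:E)%E])).
  by exists [set x | ((D - e)%:E <= f x <= (D + e)%:E)%E] => //; exact: sq.
by apply: le_ereal_inf_tmp => _ [x /andP[Dx _] <-].
Qed.

(** The difference is e^2 / (r + p), where r, the square root, is at most p + e. *)
Lemma sqrt_sqrD_sub_ge (p e : R) : 0 < p -> 0 < e ->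
  e ^+ 2 / (2 * p + e) <= Num.sqrt (p ^+ 2 + e ^+ 2) - p.
Proof.
move=> p0 e0; set r := Num.sqrt _.
have r2 : r ^+ 2 = p ^+ 2 + e ^+ 2 by rewrite sqr_sqrtr // addr_ge0 // sqr_ge0.
have r0 : 0 <= r := sqrtr_ge0 _.
have rp : p <= r by rewrite -ler_sqr ?nnegrE ?(ltW p0) // r2 lerDl sqr_ge0.
have re : r <= p + e by rewrite -ler_sqr ?nnegrE ?addr_ge0 ?(ltW p0) ?(ltW e0) // r2; nra.
have pe : 0 < 2 * p + e by lra.
rewrite ler_pdivrMr //.
have -> : e ^+ 2 = (r - p) * (r + p) by rewrite -subr_sqr r2; ring.
by rewrite ler_wpM2l ?subr_ge0 //; lra.
Qed.

Lemma ln1D_ge (x : R) : 0 <= x -> x / (1 + x) <= ln (1 + x).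
Proof.
move=> x0; have x1 : 0 < 1 + x by lra.
have := @le_ln1Dx R ((1 + x)^-1 - 1); rewrite [1 + (_ - 1)]addrC subrK lnV ?posrE //.
rewrite ltrBrDl subrr invr_gt0 x1 => /(_ isT).
have -> : x / (1 + x) = 1 - (1 + x)^-1 by field; rewrite gt_eqF.
lra.
Qed.

(** Here p and q are multiples of the two coordinates l_i that move, and kappa is the scale. Since
    sqrt (p^2 + e^2) - p is about e^2 / (2 p), the lower bound is about e sqrt (kappa (1/p + 1/q)) =
    e / s, as is the upper one. *)
Lemma dini_squeeze d (E : set 'rV[R]_d) (j : 'I_d) (x : 'rV[R]_d) (s kappa p q : R) :
  0 < s -> 0 < kappa -> 0 < p -> 0 < q -> s^-1 = Num.sqrt (kappa * (p^-1 + q^-1)) ->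
  (forall e, 0 < e < s -> (siciak (@of_real R d @` E)
      (of_real x + (0 +i* e : C) *: delta_mx 0 j)%R <= (e / (s - e))%:E)%E) ->
  (forall e, 0 < e -> ((2 * ln (1 + Num.sqrt (kappa / 2 *
      ((Num.sqrt (p ^+ 2 + e ^+ 2) - p) + (Num.sqrt (q ^+ 2 + e ^+ 2) - q)))))%:E <=
    siciak (@of_real R d @` E) (of_real x + (0 +i* e : C) *: delta_mx 0 j)%R)%E) ->
  dini E j x = (s^-1)%:E.
Proof.
move=> s0 k0 p0 q0 sE upper lower.
(* e g(e) bounds the square root in [lower] from below; the quotient by e then has a minorant [lo]
   continuous at 0 with value 1 / s. *)
pose g e := Num.sqrt (kappa / 2 * ((2 * p + e)^-1 + (2 * q + e)^-1)).
pose lo e := 2 * g e / (1 + e * g e).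
have clin r : {for 0, continuous (fun e : R => r + e)}.
  by apply: cvgD; [exact: cvg_cst|exact: cvg_id].
have cinv r : 0 < r -> {for 0, continuous (fun e : R => (2 * r + e)^-1)}.
  move=> r0; apply: cvgV; last exact: clin.
  by rewrite addr0 gt_eqF // mulr_gt0.
have cg : {for 0, continuous g}.
  apply: (@continuous_comp _ _ _
    (fun e => kappa / 2 * ((2 * p + e)^-1 + (2 * q + e)^-1)) (@Num.sqrt R)).
    by apply: cvgM; [exact: cvg_cst|apply: cvgD; exact: cinv].
  exact: sqrt_continuous.
have clo : {for 0, continuous lo}.
  apply: cvgM; first by apply: cvgM; [exact: cvg_cst|exact: cg].
  apply: cvgV; first by rewrite mul0r addr0 oner_neq0.
  by apply: cvgD; [exact: cvg_cst|apply: cvgM; [exact: cvg_id|exact: cg]].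
have lo0 : lo 0 = s^-1.
  rewrite /lo /g !addr0 mul0r addr0 divr1 sE.
  rewrite -{1}[2](@ger0_norm R) // -sqrtr_sqr -sqrtrM ?sqr_ge0 //; congr Num.sqrt.
  by field; rewrite !gt_eqF.
have chi : {for 0, continuous (fun e : R => (s - e)^-1)}.
  apply: cvgV; first by rewrite subr0 gt_eqF.
  by apply: cvgB; [exact: cvg_cst|exact: cvg_id].
apply: limf_einf_squeeze => e e0.
have nlo : \forall h \near 0^'+, s^-1 - e < lo h.
  by apply: (cvgr_gt _ (cvg_at_right_filter clo)); rewrite lo0 ltrBlDr ltrDl.
have nhi : \forall h \near 0^'+, (s - h)^-1 < s^-1 + e.
  by apply: (cvgr_lt _ (cvg_at_right_filter chi)); rewrite subr0 ltrDl.
near=> h.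
have h0 : 0 < h by near: h; exact: nbhs_right_gt.
have hs : h < s by near: h; exact: nbhs_right_lt.
apply/andP; split; last first.
  rewrite inver gt_eqF // lee_pdivrMr // (le_trans (upper h _)) ?h0 // -EFinM lee_fin mulrC.
  by rewrite ler_wpM2r ?ltW //; near: h; exact: nhi.
rewrite inver gt_eqF // lee_pdivlMr // (le_trans _ (lower h h0)) // -EFinM lee_fin.
have g0 : 0 <= h * g h by rewrite mulr_ge0 ?sqrtr_ge0 // ltW.
have gle : h * g h <= Num.sqrt (kappa / 2 *
    ((Num.sqrt (p ^+ 2 + h ^+ 2) - p) + (Num.sqrt (q ^+ 2 + h ^+ 2) - q))).
  have -> : h * g h = Num.sqrt (h ^+ 2 * (kappa / 2 * ((2 * p + h)^-1 + (2 * q + h)^-1))).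
    by rewrite sqrtrM ?sqr_ge0 // sqrtr_sqr ger0_norm // ltW.
  have hp := sqrt_sqrD_sub_ge p0 h0; have hq := sqrt_sqrD_sub_ge q0 h0.
  have hp0 : 0 <= h ^+ 2 / (2 * p + h) by rewrite divr_ge0 ?sqr_ge0 //; lra.
  have hq0 : 0 <= h ^+ 2 / (2 * q + h) by rewrite divr_ge0 ?sqr_ge0 //; lra.
  rewrite ler_sqrt; last by rewrite mulr_ge0 ?divr_ge0 ?(ltW k0) //; lra.
  by rewrite mulrCA ler_pM2l ?divr_gt0 // mulrDr; lra.
apply: (@le_trans _ _ (2 * (h * g h / (1 + h * g h)))).
  rewrite (_ : 2 * _ = lo h * h); last by rewrite /lo; ring.
  by rewrite ler_pM2r // ltW //; near: h.
rewrite ler_pM2l // (le_trans (ln1D_ge g0)) // ler_ln ?posrE ?lerD2l //.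
by rewrite ltr_wpDr // sqrtr_ge0.
Unshelve. all: end_near. Qed.

End DiniSqueeze.

(** * Lower bounds on the trapezoid and a half-plane criterion for ellipses *)

Section Trapezoid.
Context {R : realType}.
Local Notation C := (R[i]^o).
Local Notation normc := Normc.normc.
Local Open Scope complex_scope.
Local Notation T := (@of_real R 2 @` trapezoid R).

(** The point can be moved a little along both axes in both senses; each of the four inequalities
    becomes strict by one of these moves. *)
Lemma trapezoid_interior (p : 'rV[R]_2) : interior (trapezoid R) p ->
  0 < p 0 1 < 1 /\ 0 < p 0 0 < 2 - p 0 1.
Proof.
move=> ip; have dir (d : 'rV[R]_2) : exists2 t : R, 0 < t & trapezoid R (p + t *: d).
  have cd : continuous (fun t : R => p + t *: d).
    apply: continuous_to_mx => i j t; under eq_fun do rewrite !mxE.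
    by apply: cvgD; [exact: cvg_cst|apply: cvgM; [exact: cvg_id|exact: cvg_cst]].
  have near0 : \forall t \near (0 : R), trapezoid R (p + t *: d).
    by apply: (cd 0); rewrite scale0r addr0.
  have [e /= e0 he] := near0; exists (e / 2); first exact: divr_gt0.
  apply: he => /=; rewrite sub0r normrN gtr0_norm ?divr_gt0 //.
  by rewrite ltr_pdivrMr // ltr_pMr // ltr1n.
have [t1 t10 T1] := dir (delta_mx 0 0); have [t2 t20 T2] := dir (- delta_mx 0 0).
have [t3 t30 T3] := dir (delta_mx 0 1); have [t4 t40 T4] := dir (- delta_mx 0 1).
move: T1 T2 T3 T4; rewrite /trapezoid /= !mxE /= => -[] /andP[? ?] /andP[? ?].
move=> -[] /andP[? ?] /andP[? ?] -[] /andP[? ?] /andP[? ?] -[] /andP[? ?] /andP[? ?].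
by split; apply/andP; split; lra.
Qed.

Lemma normc_le_enorm d (z : 'rV[C]_d) k : normc (z 0 k) <= enorm z.
Proof.
rewrite -[leLHS]ger0_norm ?normc_ge0 // -sqrtr_sqr ler_sqrt.
  by rewrite (bigD1 k) //= lerDl sumr_ge0 // => i _; exact: sqr_ge0.
by apply: sumr_ge0 => i _; exact: sqr_ge0.
Qed.

Lemma normc_real (x : R) : normc (x%:C : R[i]) = `|x|.
Proof. by rewrite /= expr0n addr0 sqrtr_sqr. Qed.

Lemma siciak_trapezoid_ge_simplex (w : 'rV[C]_2) :
  ((2 * ln (1 + Num.sqrt ((normc (2^-1%:C * w 0 0) + normc (2^-1%:C * w 0 1) +
     normc (1 - 2^-1%:C * w 0 0 - 2^-1%:C * w 0 1) - 1) / 2)))%:E <= siciak T w)%E.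
Proof.
pose l0 (z : 'rV[C]_2) : C := 2^-1%:C * z 0 0.
pose l1 (z : 'rV[C]_2) : C := 2^-1%:C * z 0 1.
pose l2 (z : 'rV[C]_2) : C := 1 - 2^-1%:C * z 0 0 - 2^-1%:C * z 0 1.
have P0 : polynomial_fun l0.
  by apply: polynomial_funM; [exact: polynomial_fun_cst|exact: polynomial_fun_coord].
have P1 : polynomial_fun l1.
  by apply: polynomial_funM; [exact: polynomial_fun_cst|exact: polynomial_fun_coord].
have P2 : polynomial_fun l2.
  have -> : l2 = fun z => 1 + ((-1) * l0 z + (-1) * l1 z).
    by apply/funext => z; rewrite /l2 /l0 /l1; ring.
  apply: polynomial_funD; first exact: polynomial_fun_cst.
  by apply: polynomial_funD; apply: polynomial_funM => //; exact: polynomial_fun_cst.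
apply: (@siciak_ge_simplex R 2 T l0 l1 l2 1 w P0 P1 P2) => //.
- move=> z; rewrite mul1r.
  have h0 := normc_le_enorm z 0; have h1 := normc_le_enorm z 1.
  have n2 : normc (2^-1%:C : R[i]) = 2^-1 by rewrite normc_real ger0_norm.
  have e0 : normc (l0 z) = 2^-1 * normc (z 0 0) by rewrite Normc.normcM n2.
  have e1 : normc (l1 z) = 2^-1 * normc (z 0 1) by rewrite Normc.normcM n2.
  have := normc_ge0 (z 0 0); have := normc_ge0 (z 0 1).
  have : normc (l2 z) <= 1 + normc (l0 z) + normc (l1 z).
    rewrite (le_trans (ler_normc_add _ _)) // normc_opp lerD2r.
    by rewrite (le_trans (ler_normc_add _ _)) // normc_opp Normc.normc1.
  by split; lra.
- move=> _ [q [/andP[y0 y1] /andP[x0 x1]] <-].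
  exists (Num.sqrt (q 0 0 / 2)), (Num.sqrt (q 0 1 / 2)), (Num.sqrt (1 - q 0 0 / 2 - q 0 1 / 2)).
  rewrite !sqr_sqrtr; [|lra..].
  rewrite /l0 /l1 /l2 !mxE; split; [by rewrite -rmorphM mulrC|by rewrite -rmorphM mulrC| |by ring].
  by rewrite -!rmorphM -(rmorph1 (real_complex R)) -!rmorphB !(mulrC 2^-1).
- by rewrite /l0 /l1 /l2; ring.
Qed.

Lemma siciak_trapezoid_ge_strip (w : 'rV[C]_2) :
  ((2 * ln (1 + Num.sqrt ((normc (w 0 1) + normc (1 - w 0 1) - 1) / 2)))%:E <= siciak T w)%E.
Proof.
pose l0 (z : 'rV[C]_2) : C := 0.
pose l1 (z : 'rV[C]_2) : C := z 0 1.
pose l2 (z : 'rV[C]_2) : C := 1 - z 0 1.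
have P0 : polynomial_fun l0 by exact: polynomial_fun_cst.
have P1 : polynomial_fun l1 by exact: polynomial_fun_coord.
have P2 : polynomial_fun l2.
  have -> : l2 = fun z => 1 + ((-1) * l1 z) by apply/funext => z; rewrite /l2 /l1; ring.
  apply: polynomial_funD; first exact: polynomial_fun_cst.
  by apply: polynomial_funM => //; exact: polynomial_fun_cst.
have -> : normc (w 0 1) = normc (l0 w) + normc (w 0 1) by rewrite Normc.normc0 add0r.
apply: (@siciak_ge_simplex R 2 T l0 l1 l2 1 w P0 P1 P2) => //.
- move=> z; rewrite mul1r.
  have h1 := normc_le_enorm z 1; have h0 := enorm_ge0 z.
  have : normc (l2 z) <= 1 + normc (l1 z).
    by rewrite (le_trans (ler_normc_add _ _)) // normc_opp Normc.normc1.
  have : normc (l0 z) = 0 := Normc.normc0 _.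
  by rewrite /l1; split; lra.
- move=> _ [q [/andP[y0 y1] _] <-].
  exists 0, (Num.sqrt (q 0 1)), (Num.sqrt (1 - q 0 1)).
  rewrite !sqr_sqrtr; [|lra..].
  rewrite /l0 /l1 /l2 !mxE expr0n; split=> //=; last by ring.
  by rewrite -(rmorph1 (real_complex R)) -rmorphB.
- by rewrite /l0 /l1 /l2; ring.
Qed.

(** Cauchy-Schwarz. For an affine function with value A at the centre of an ellipse and increments
    B, W along two conjugate semi-diameters, this is the test for the ellipse to lie in its half
    plane; equality B^2 + W^2 = A^2 is tangency. *)
Lemma affine_disk_ge0 (A B W c s : R) : 0 <= A -> B ^+ 2 + W ^+ 2 <= A ^+ 2 ->
  c ^+ 2 + s ^+ 2 <= 1 -> 0 <= A + c * B + s * W.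
Proof.
move=> A0 BW cs; pose u := c * B + s * W.
have u2 : u ^+ 2 <= A ^+ 2.
  apply: (@le_trans _ _ ((c ^+ 2 + s ^+ 2) * (B ^+ 2 + W ^+ 2))).
    rewrite -subr_ge0.
    have -> : (c ^+ 2 + s ^+ 2) * (B ^+ 2 + W ^+ 2) - u ^+ 2 = (c * W - s * B) ^+ 2.
      by rewrite /u; ring.
    exact: sqr_ge0.
  apply: (le_trans _ BW); rewrite ler_piMl // addr_ge0 ?sqr_ge0 //.
have : `|u| <= A by rewrite -ler_sqr ?nnegrE // real_normK ?num_real.
by rewrite ler_norml /u => /andP[? _]; lra.
Qed.

End Trapezoid.

(** * Tangent ellipses and the Dini derivatives *)

Section TrapezoidDini.
Context {R : realType}.
Local Notation C := (R[i]^o).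
Local Notation normc := Normc.normc.
Local Open Scope complex_scope.
Local Notation T := (@of_real R 2 @` trapezoid R).
Implicit Types (x y : R) (p : 'rV[R]_2).

Definition row2 x y : 'rV[R]_2 := \row_k (if k == 0 then x else y).

Lemma row2_eq p : p = row2 (p 0 0) (p 0 1).
Proof.
apply/rowP => -[[|[|//]] k2]; rewrite mxE /=; congr (p _ _); exact: val_inj.
Qed.

Lemma trapezoidP p : [/\ 0 <= p 0 1, 0 <= 1 - p 0 1, 0 <= p 0 0 & 0 <= 2 - p 0 0 - p 0 1] ->
  trapezoid R p.
Proof. by move=> [h1 h2 h3 h4]; split; apply/andP; split; lra. Qed.

(** Only x/2 and (2 - x - y)/2 leave the real line; subtracting the real values, of sum 1, from h
    leaves the scale kappa = 1/2. *)
Lemma siciak_trapezoid_imag_x_ge x y e : 0 < x -> 0 < y -> 0 < 2 - x - y ->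
  ((2 * ln (1 + Num.sqrt (2^-1 / 2 * ((Num.sqrt (x ^+ 2 + e ^+ 2) - x) +
     (Num.sqrt ((2 - x - y) ^+ 2 + e ^+ 2) - (2 - x - y))))))%:E <=
    siciak T (of_real (row2 x y) + (0 +i* e : C) *: delta_mx 0 0)%R)%E.
Proof.
move=> x0 y0 z0; set w := (X in siciak _ X).
have w0 : w 0 0 = x +i* e.
  by rewrite !mxE /=; apply: complex_eq => /=; ring.
have w1 : w 0 1 = y%:C.
  by rewrite !mxE /=; apply: complex_eq => /=; ring.
have := siciak_trapezoid_ge_simplex w; rewrite w0 w1.
have -> : normc (2^-1%:C * (x +i* e)) = 2^-1 * Num.sqrt (x ^+ 2 + e ^+ 2).
  by rewrite Normc.normcM normc_real ger0_norm.
have -> : normc (2^-1%:C * y%:C : R[i]) = 2^-1 * y.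
  by rewrite Normc.normcM !normc_real !ger0_norm // ltW.
have -> : 1 - 2^-1%:C * (x +i* e) - 2^-1%:C * y%:C = 2^-1%:C * ((2 - x - y) -i* e).
  by apply: complex_eq => /=; field.
rewrite Normc.normcM normc_real ger0_norm //=.
by congr (_ <= _)%E; congr (2 * ln (1 + Num.sqrt _))%:E; rewrite sqrrN; field.
Qed.

Lemma siciak_trapezoid_imag_y_ge x y e : 0 < x -> 0 < y -> 0 < 2 - x - y ->
  ((2 * ln (1 + Num.sqrt (2^-1 / 2 * ((Num.sqrt (y ^+ 2 + e ^+ 2) - y) +
     (Num.sqrt ((2 - x - y) ^+ 2 + e ^+ 2) - (2 - x - y))))))%:E <=
    siciak T (of_real (row2 x y) + (0 +i* e : C) *: delta_mx 0 1)%R)%E.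
Proof.
move=> x0 y0 z0; set w := (X in siciak _ X).
have w0 : w 0 0 = x%:C.
  by rewrite !mxE /=; apply: complex_eq => /=; ring.
have w1 : w 0 1 = y +i* e.
  by rewrite !mxE /=; apply: complex_eq => /=; ring.
have := siciak_trapezoid_ge_simplex w; rewrite w0 w1.
have -> : normc (2^-1%:C * (y +i* e)) = 2^-1 * Num.sqrt (y ^+ 2 + e ^+ 2).
  by rewrite Normc.normcM normc_real ger0_norm.
have -> : normc (2^-1%:C * x%:C : R[i]) = 2^-1 * x.
  by rewrite Normc.normcM !normc_real !ger0_norm // ltW.
have -> : 1 - 2^-1%:C * x%:C - 2^-1%:C * (y +i* e) = 2^-1%:C * ((2 - x - y) -i* e).
  by apply: complex_eq => /=; field.
rewrite Normc.normcM normc_real ger0_norm //=.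
by congr (_ <= _)%E; congr (2 * ln (1 + Num.sqrt _))%:E; rewrite sqrrN; field.
Qed.

Lemma siciak_trapezoid_imag_y_ge_strip x y e :
  ((2 * ln (1 + Num.sqrt (1 / 2 * ((Num.sqrt (y ^+ 2 + e ^+ 2) - y) +
     (Num.sqrt ((1 - y) ^+ 2 + e ^+ 2) - (1 - y))))))%:E <=
    siciak T (of_real (row2 x y) + (0 +i* e : C) *: delta_mx 0 1)%R)%E.
Proof.
set w := (X in siciak _ X).
have w1 : w 0 1 = y +i* e.
  by rewrite !mxE /=; apply: complex_eq => /=; ring.
have := siciak_trapezoid_ge_strip w; rewrite w1.
have -> : 1 - (y +i* e) = (1 - y) -i* e by apply: complex_eq => /=; ring.
rewrite /=.
by congr (_ <= _)%E; congr (2 * ln (1 + Num.sqrt _))%:E; rewrite sqrrN; field.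
Qed.

(** The ellipse touches x = 0, y = 0 and x + y = 2 and has (x, y) as its highest point, so it
    remains below y = 1. With m = (2 - x - y) / (2 - y) its centre is (x/2 + m, y/2), and tangency
    to x = 0 reads s^2 = 2 x m. *)
Lemma dini_trapezoid_x x y : 0 < x -> 0 < y < 1 -> 0 < 2 - x - y ->
  dini (trapezoid R) 0 (row2 x y) =
    ((Num.sqrt (2 * x * (2 - x - y) / (2 - y)))^-1)%:E.
Proof.
move=> x0 /andP[y0 y1] z0; set s := Num.sqrt _; set z := 2 - x - y in z0 s *.
have D0 : 0 < 2 - y by lra.
have s2 : s ^+ 2 = 2 * x * z / (2 - y).
  by rewrite sqr_sqrtr // divr_ge0 ?ltW // !mulr_gt0.
have s0 : 0 < s by rewrite sqrtr_gt0 divr_gt0 // !mulr_gt0.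
apply: (@dini_squeeze R 2 _ 0 (row2 x y) s 2^-1 x z) => //.
- rewrite /s -sqrtrV -?s2 ?sqr_ge0 // s2; congr Num.sqrt; rewrite /z.
  by field; rewrite !gt_eqF.
- move=> e es.
  have -> : row2 x y = row2 (x / 2 + z / (2 - y)) (y / 2) + row2 (x / 2 - z / (2 - y)) (y / 2).
    by apply/rowP => k; rewrite !mxE; case: ifP => _; field; rewrite ?gt_eqF.
  apply: siciak_le_ellipse => // c t ct; apply: trapezoidP; rewrite !mxE /=.
  pose m := z / (2 - y); have m0 : 0 < m by rewrite divr_gt0.
  have sE : s ^+ 2 = 2 * x * m by rewrite s2 /m mulrA.
  have zE : m * (2 - y) = z by rewrite divfK // gt_eqF.
  have A1 : 0 <= y / 2 by lra.
  rewrite -/m; split.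
  + have := @affine_disk_ge0 R (y / 2) (y / 2) 0 c t A1 _ ct.
    by rewrite expr0n addr0 => /(_ (lexx _)); lra.
  + have := @affine_disk_ge0 R (1 - y / 2) (- (y / 2)) 0 c t _ _ ct.
    rewrite expr0n addr0 => h.
    have : 0 <= 1 - y / 2 + c * - (y / 2) + t * 0 by apply: h; [lra|nra].
    lra.
  + have h : 0 <= (x / 2 + m) + c * (x / 2 - m) + t * s.
      by apply: affine_disk_ge0 => //; [lra|rewrite sE; nra].
    lra.
  + have h : 0 <= (2 - (x / 2 + m) - y / 2) + c * - (x / 2 - m + y / 2) + t * - s.
      apply: affine_disk_ge0 => //.
        have : m <= 1 by rewrite ler_pdivrMr // mul1r /z; lra.
        by rewrite /z in z0; lra.
      rewrite !sqrrN sE le_eqVlt; apply/orP; left; apply/eqP.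
      have xE : x = m * (2 - y) * (-1) + (2 - y) by rewrite zE /z; ring.
      by rewrite xE; field.
    lra.
- by move=> e e0; exact: siciak_trapezoid_imag_x_ge.
Qed.

(** The ellipse touches the same three lines with (x, y) as its rightmost point. It touches y = 0
    and has centre at height y/2 + m, so it stays below y = 1 when y/2 + m <= 1/2, which is the
    hypothesis 2 <= x + x y. *)
Lemma dini_trapezoid_y_simplex x y : 0 < x -> 0 < y < 1 -> 0 < 2 - x - y ->
  2 <= x + x * y ->
  dini (trapezoid R) 1 (row2 x y) =
    ((Num.sqrt (2 * y * (2 - x - y) / (2 - x)))^-1)%:E.
Proof.
move=> x0 /andP[y0 y1] z0 xy; set s := Num.sqrt _; set z := 2 - x - y in z0 s *.
have D0 : 0 < 2 - x by rewrite /z in z0; lra.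
have s2 : s ^+ 2 = 2 * y * z / (2 - x).
  by rewrite sqr_sqrtr // divr_ge0 ?ltW // !mulr_gt0.
have s0 : 0 < s by rewrite sqrtr_gt0 divr_gt0 // !mulr_gt0.
apply: (@dini_squeeze R 2 _ 1 (row2 x y) s 2^-1 y z) => //.
- rewrite /s -sqrtrV -?s2 ?sqr_ge0 // s2; congr Num.sqrt; rewrite /z.
  by field; rewrite !gt_eqF.
- move=> e es.
  have -> : row2 x y = row2 (x / 2) (y / 2 + z / (2 - x)) + row2 (x / 2) (y / 2 - z / (2 - x)).
    by apply/rowP => k; rewrite !mxE; case: ifP => _; field; rewrite ?gt_eqF.
  apply: siciak_le_ellipse => // c t ct; apply: trapezoidP; rewrite !mxE /=.
  pose m := z / (2 - x); have m0 : 0 < m by rewrite divr_gt0.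
  have sE : s ^+ 2 = 2 * y * m by rewrite s2 /m mulrA.
  have zE : m * (2 - x) = z by rewrite divfK // gt_eqF.
  have mh : y / 2 + m <= 1 / 2.
    have : m <= (1 - y) / 2 by rewrite ler_pdivrMr // /z; nra.
    lra.
  rewrite -/m; split.
  + have h : 0 <= (y / 2 + m) + c * (y / 2 - m) + t * s.
      by apply: affine_disk_ge0 => //; [lra|rewrite sE; nra].
    lra.
  + have h : 0 <= (1 - (y / 2 + m)) + c * - (y / 2 - m) + t * - s.
      by apply: affine_disk_ge0 => //; [lra|rewrite !sqrrN sE; nra].
    lra.
  + have h : 0 <= x / 2 + c * (x / 2) + t * 0.
      by apply: affine_disk_ge0 => //; [lra|rewrite expr0n addr0].
    lra.
  + have h : 0 <= (2 - x / 2 - (y / 2 + m)) + c * - (x / 2 + (y / 2 - m)) + t * - s.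
      apply: affine_disk_ge0 => //; first by rewrite /z in z0; lra.
      rewrite !sqrrN sE le_eqVlt; apply/orP; left; apply/eqP.
      have yE : y = m * (2 - x) * (-1) + (2 - x) by rewrite zE /z; ring.
      by rewrite yE; field.
    lra.
- by move=> e e0; exact: siciak_trapezoid_imag_y_ge.
Qed.

(** The ellipse with centre (x/2, 1/2) and rightmost point (x, y) touches x = 0, y = 0 and y = 1.
    For the side x + y = 2 the difference A^2 - B^2 - W^2 equals 2 - x - x y. *)
Lemma dini_trapezoid_y_strip x y : 0 < x -> 0 < y < 1 -> 0 < 2 - x - y ->
  x + x * y <= 2 ->
  dini (trapezoid R) 1 (row2 x y) = ((Num.sqrt (y * (1 - y)))^-1)%:E.
Proof.
move=> x0 /andP[y0 y1] z0 xy; set s := Num.sqrt _.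
have y1' : 0 < 1 - y by rewrite subr_gt0.
have s2 : s ^+ 2 = y * (1 - y) by rewrite sqr_sqrtr // ltW // mulr_gt0.
have s0 : 0 < s by rewrite sqrtr_gt0 mulr_gt0.
apply: (@dini_squeeze R 2 _ 1 (row2 x y) s 1 y (1 - y)) => //.
- rewrite /s -sqrtrV -?s2 ?sqr_ge0 // s2; congr Num.sqrt.
  by field; rewrite !gt_eqF.
- move=> e es.
  have -> : row2 x y = row2 (x / 2) (1 / 2) + row2 (x / 2) (y - 1 / 2).
    by apply/rowP => k; rewrite !mxE; case: ifP => _; field.
  apply: siciak_le_ellipse => // c t ct; apply: trapezoidP; rewrite !mxE /=.
  split.
  + have h : 0 <= 1 / 2 + c * (y - 1 / 2) + t * s.
      by apply: affine_disk_ge0 => //; rewrite s2; nra.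
    lra.
  + have h : 0 <= 1 / 2 + c * - (y - 1 / 2) + t * - s.
      by apply: affine_disk_ge0 => //; rewrite !sqrrN s2; nra.
    lra.
  + have h : 0 <= x / 2 + c * (x / 2) + t * 0.
      by apply: affine_disk_ge0 => //; [lra|rewrite expr0n addr0].
    lra.
  + have h : 0 <= (2 - x / 2 - 1 / 2) + c * - (x / 2 + (y - 1 / 2)) + t * - s.
      by apply: affine_disk_ge0 => //; [lra|rewrite !sqrrN s2; nra].
    lra.
- by move=> e e0; exact: siciak_trapezoid_imag_y_ge_strip.
Qed.

End TrapezoidDini.

(** The inverse of m is the minimum of f and r g. *)
Lemma inv_max_bounds (R : realType) (f g r : R) : 0 < f -> 0 < g -> 1 <= r ->
  let m := Num.max (1 / (r * g)) (1 / f) in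
  [/\ 0 < m, Num.min f g <= m^-1 & m^-1 <= r * Num.min f g].
Proof.
move=> f0 g0 r1 m; have r0 : 0 < r := lt_le_trans ltr01 r1.
have rg0 : 0 < r * g by rewrite mulr_gt0.
have m0 : 0 < m by rewrite lt_max !divr_gt0.
have mg : 1 / (r * g) <= m by rewrite le_max lexx.
have mf : 1 / f <= m by rewrite le_max lexx orbT.
split=> //.
  rewrite -[leLHS]invrK lef_pV2 ?posrE ?invr_gt0 ?lt_min ?f0 //.
  rewrite ge_max !div1r !lef_pV2 ?posrE ?lt_min ?f0 // !ge_min lexx andbT.
  by rewrite (_ : g <= r * g) ?orbT // ler_peMl // ltW.
rewrite -[leRHS]invrK lef_pV2 ?posrE ?invr_gt0 ?mulr_gt0 ?lt_min ?f0 //.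
have [fg|gf] := leP f g; last by rewrite -div1r.
by apply: le_trans mf; rewrite div1r lef_pV2 ?posrE ?mulr_gt0 // ler_peMl // ltW.
Qed.

Theorem mainTheorem5 (R : realType) (p : 'rV[R]_2)
    (hp : interior (trapezoid R) p) :
  let x := p 0 0 in
  let y := p 0 1 in
  let D1 := dini (trapezoid R) 0 p in
  let D2 := dini (trapezoid R) 1 p in
  [/\ D1 = (Num.sqrt (2 - y) /
            (Num.sqrt 2 * Num.sqrt x * Num.sqrt (2 - x - y)))%:E,
      D1 = (1 / (Num.sqrt 2 * Phix x y))%:E,
      D2 = (Num.max (Num.sqrt (2 - x) /
                      (Num.sqrt 2 * Num.sqrt y * Num.sqrt (2 - x - y)))
                    (1 / Num.sqrt (y * (1 - y))))%:E &
      ((Phiy x y)%:E <= 1 / D2)%E /\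
      (1 / D2 <= (Num.sqrt 2 * Phiy x y)%:E)%E].
Proof.
move=> x y D1 D2; have [/andP[y0 y1] /andP[x0 xy2]] := trapezoid_interior hp.
rewrite -/x -/y in y0 y1 x0 xy2.
have z0 : 0 < 2 - x - y by lra.
have y01 : 0 < y < 1 by rewrite y0.
have y1' : 0 < 1 - y by lra.
have Dy0 : 0 < 2 - y by lra.
have Dx0 : 0 < 2 - x by lra.
have pE : p = row2 x y := row2_eq p.
have [s2 sx sy] : [/\ 0 < Num.sqrt 2 :> R, 0 < Num.sqrt x & 0 < Num.sqrt y].
  by rewrite !sqrtr_gt0.
have [sz sDx sDy] : [/\ 0 < Num.sqrt (2 - x - y), 0 < Num.sqrt (2 - x) & 0 < Num.sqrt (2 - y)].
  by rewrite !sqrtr_gt0.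
have sE u v : 0 <= u -> 0 <= v -> Num.sqrt (2 * u * (2 - x - y) / v) =
    Num.sqrt 2 * Num.sqrt u * Num.sqrt (2 - x - y) / Num.sqrt v.
  by have z0' := ltW z0; move=> u0 v0; rewrite !sqrtrM ?sqrtrV ?mulr_ge0.
have D1E : D1 = (Num.sqrt (2 - y) / (Num.sqrt 2 * Num.sqrt x * Num.sqrt (2 - x - y)))%:E.
  by rewrite /D1 pE dini_trapezoid_x // sE ?ltW // invf_div.
pose f := Num.sqrt (y * (1 - y)).
pose g := Num.sqrt y * Num.sqrt (2 - x - y) / Num.sqrt (2 - x).
have f0 : 0 < f by rewrite sqrtr_gt0 mulr_gt0.
have g0 : 0 < g by rewrite divr_gt0 // mulr_gt0.
have gE : Num.sqrt (2 - x) / (Num.sqrt 2 * Num.sqrt y * Num.sqrt (2 - x - y)) =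
    1 / (Num.sqrt 2 * g).
  by rewrite /g; field; rewrite !gt_eqF.
have rgE : Num.sqrt 2 * g = Num.sqrt (2 * y * (2 - x - y) / (2 - x)).
  by rewrite sE ?ltW // /g !mulrA.
have D2E : D2 = (Num.max (1 / (Num.sqrt 2 * g)) (1 / f))%:E.
  have rg0 : 0 < Num.sqrt 2 * g by rewrite mulr_gt0.
  have fpos : 0 < y * (1 - y) by rewrite mulr_gt0.
  have gpos : 0 < 2 * y * (2 - x - y) / (2 - x) by rewrite divr_gt0 // !mulr_gt0.
  (* Comparing the squares of the two terms of the maximum, (2 - x)(1 - y) against 2 (2 - x - y),
     gives the sign of x + x y - 2: each ellipse is admissible exactly where its term is the larger
     one. *)
  rewrite /D2 pE; have [xy|xy] := leP 2 (x + x * y).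
    rewrite dini_trapezoid_y_simplex // -rgE max_l ?div1r // lef_pV2 ?posrE //.
    rewrite rgE /f (ler_sqrt _ (ltW fpos)) ler_pdivrMr //.
    have -> : 2 * y * (2 - x - y) = y * (2 * (2 - x - y)) by ring.
    by rewrite -mulrA ler_pM2l //; nra.
  rewrite dini_trapezoid_y_strip ?ltW // -/f max_r ?div1r // lef_pV2 ?posrE //.
  rewrite rgE /f (ler_sqrt _ (ltW gpos)) ler_pdivlMr //.
  have -> : 2 * y * (2 - x - y) = y * (2 * (2 - x - y)) by ring.
  by rewrite -mulrA ler_pM2l //; nra.
have r1 : 1 <= Num.sqrt 2 :> R by rewrite -[leLHS]sqrtr1 ler_sqrt // ler1n.
have [m0 low up] := inv_max_bounds f0 g0 r1.
split => //.
- rewrite D1E; congr EFin; rewrite /Phix sqrtrM ?mulr_ge0 ?ltW // sqrtrM ?ltW // sqrtrV ?ltW //.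
  by field; rewrite !gt_eqF.
- by rewrite D2E gE.
- by rewrite D2E inver gt_eqF // mul1e !lee_fin /Phiy.
Qed.
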